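(* Let $m\ge 1$ be an integer. For each $n$ let $\mu=\mu(n)>0$ and let $A=A_n$ be a probability distribution function of a nonnegative random variable with finite positive mean $1/\lambda$, $\lambda=\lambda(n)$, and let $p_{m,n}$ be the stationary loss probability of the $GI/M/m/n$ queueing system with interarrival time distribution $A_n$ and service rate $\mu(n)$. Put $$\varrho=\varrho(n)=\frac{\lambda(n)}{m\mu(n)},\qquad \varrho_k(n)=\int_0^\infty(\mu(n)\,m\,x)^k\,dA_n(x),\quad k=2,3.$$ Suppose that $\varrho=1-\varepsilon$ with $\varepsilon=\varepsilon(n)>0$, and that $\varepsilon\to0$ and $\varepsilon n\to C$ as $n\to\infty$, where $C\in[0,\infty)$. Assume that $\varrho_3(n)$ is a bounded sequence in $n$ and that the limit $\widetilde\varrho_2=\lim_{n\to\infty}\varrho_2(n)$ exists. If $C>0$, then, as $n\to\infty$, $$p_{m,n}=\frac{\varepsilon\, e^{-2C/\widetilde\varrho_2}}{1-e^{-2C/\widetilde\varrho_2}}\,[1+o(1)].$$ If $C=0$, then, as $n\to\infty$, $$p_{m,n}=\frac{\widetilde\varrho_2}{2n}+o\Big(\frac1n\Big).$$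
   Context: The $GI/M/m/n$ queueing system has $m$ identical servers and $n$ waiting places (so at most $m+n$ customers can be present). Customers arrive one at a time; interarrival times are independent with common distribution function $A$, of mean $1/\lambda$. Service times are independent, exponentially distributed with rate $\mu$, and independent of the arrivals. An arriving customer who finds all $m$ servers busy and all $n$ waiting places occupied is lost. The load is $\varrho=\lambda/(m\mu)$. The parameter $\mu$ and the distribution $A$ (one or both of them) are allowed to depend on $n$, and hence so do $\varrho$, $\varrho_2$, $\varrho_3$ and $\varepsilon$; the number $m$ is fixed. The stationary loss probability $p_{m,n}$ is the stationary probability that an arriving customer is lost, i.e. the mass at state $m+n$ of the stationary distribution of the Markov chain on $\{0,1,\dots,m+n\}$ recording the number of customers in the system immediately before successive arrivals. (From state $i$, the chain moves as follows: after the arrival the number present is $\min(i+1,m+n)$; then, during an independent interarrival time with distribution $A$, the number present evolves as a pure death process with death rate $\mu\min(k,m)$ when $k$ customers are present.) Equivalently, $1/p_{m,n}$ is the expected number of arrivals between consecutive losses in the stationary regime. *)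

(* Defs.v *)
From HB Require Import structures.
From mathcomp Require Import all_boot all_order all_algebra.
From mathcomp Require Import all_classical all_reals all_analysis.

Set Implicit Arguments.
Unset Strict Implicit.
Unset Printing Implicit Defensive.

Import Order.TTheory GRing.Theory Num.Theory.
Import numFieldNormedType.Exports.

Local Open Scope classical_set_scope.
Local Open Scope ring_scope.

Definition death_rate (R : realType) (m : nat) (mu : R) (k : nat) : R :=
  mu * (minn k m)%:R.

(* Probability that the pure death process with rates [death_rate m mu],
   started in state k, is in state j at time t >= 0.  The process stays in
   k > 0 for an exponential time with rate [death_rate m mu k], then restarts
   from k - 1; state 0 is absorbing.  For j < k the clause conditions on the
   time s at which k is left; for j > k the recursion yields 0. *)
Fixpoint death_prob (R : realType) (m : nat) (mu : R) (k j : nat) (t : R) : R :=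
  match k with
  | 0%N => (j == 0%N)%:R
  | k'.+1 =>
      if j == k'.+1 then expR (- (death_rate m mu k'.+1 * t))
      else \int[lebesgue_measure]_(s in `[0, t])
             (death_rate m mu k'.+1 * expR (- (death_rate m mu k'.+1 * s))
              * death_prob m mu k' j (t - s))
  end.

(* An interarrival time distribution is given by its law on the Borel line,
   concentrated on [0, +oo[. *)
Definition nonneg_law (R : realType) (A : probability (measurableTypeR R) R) :
    Prop :=
  A [set x : R | x < 0] = 0%E.

(* Chain of the number of customers just before arrivals in GI/M/m/n.  The
   minimum accounts for the loss of a customer who finds m + n present. *)
Definition arrival_chain (R : realType) (m n : nat) (mu : R)
    (A : probability (measurableTypeR R) R) : 'M[R]_((m + n).+1) :=
  \matrix_(i, j) \int[A]_(x in `[0, +oo[)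
                   death_prob m mu (minn i.+1 (m + n)) j x.

Definition stationary (R : realType) (N : nat) (P : 'M[R]_N) (v : 'rV[R]_N) :
    Prop :=
  [/\ forall j, 0 <= v 0 j, \sum_j v 0 j = 1 & v *m P = v].

Definition is_loss_probability (R : realType) (m n : nat) (mu : R)
    (A : probability (measurableTypeR R) R) (p : R) : Prop :=
  exists2 v, stationary (arrival_chain m n mu A) v & p = v 0 ord_max.

(* Extended-real valued, so that infinite moments are not collapsed to 0. *)
Definition rho_moment (R : realType) (m : nat) (mu : R)
    (A : probability (measurableTypeR R) R) (k : nat) : \bar R :=
  (\int[A]_(x in `[0%R, +oo[) ((mu * m%:R * x) ^+ k)%:E)%E.

Definition mean (R : realType) (A : probability (measurableTypeR R) R) :
    \bar R :=
  (\int[A]_(x in `[0%R, +oo[) x%:E)%E.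

(* Main.v *)
Require Import Defs.
From HB Require Import structures.
From mathcomp Require Import all_boot all_order all_algebra.
From mathcomp Require Import all_classical all_reals all_analysis.
From mathcomp Require Import measurable_realfun ring lra.

(** Scale time so that m busy servers complete services at rate 1, and let T be
    an interarrival time, e_k = E T^k, N = m + n. While all servers are busy,
    the number of customers seen by successive arrivals is a random walk with
    steps 1 - (Poisson variable of mean T), whose drift is
    1 - e_1 = - eps / (1 - eps) and whose variance is close to e_2. The loss
    probability p is the mass of its stationary law at the upper barrier N, and
    it is read off from the stationarity identity
    sum_i v_i (E f(next state from i) - f(i)) = 0 for three test functions f.

    For each of them the death process is compared with the process in which m
    servers always work. That process has explicit solutions U of its backward
    equation: k - t, (k - t)^2 + t and w^k exp(- theta t) with
    w = 1 / (1 - theta). The difference between the true mean of f and U (the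
    idle gap) is produced only by periods with idle servers, and the comparison
    principle [idle_gap_le] shows that it is monotone in the increments
    U(k) - U(k - 1) at the levels k <= m. Hence the idle gaps of the quadratic
    and exponential functions are sandwiched between multiples of the linear
    one, and stationarity for f(k) = k gives the stationary mean L of the latter
    exactly: L = e_1 - 1 + p ([mean_idleE]). The lower bounds also involve the
    same mean weighted by T. The third moment controls it by (1 + M) sqrt L,
    after truncating at T = 1 / sqrt L ([mean_weighted_idle_le],
    [mean_weighted_idle_sqrt]).

    The quadratic function yields p (2 N + 1 - 2 e_1) = e_2 + O(n eps) + O(L)
    + O(sqrt L) ([loss_quad_upper], [loss_quad_estimate]). Its one-sided form
    gives p = O(1/n), so L tends to 0; when n eps tends to 0 the two-sided form
    gives p ~ rho2 / (2 n). When n eps tends to C > 0, take the exponential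
    function with theta = 2 eps / rho2, which cancels the drift of the walk up
    to o(theta^2). What remains is p (w^N - 1) = (e_1 - 1) + o(theta)
    ([loss_exp_estimate]); since w^N tends to exp(2 C / rho2) and
    e_1 - 1 ~ eps, this is p ~ eps / (exp(2 C / rho2) - 1). *)

Set Implicit Arguments.
Unset Strict Implicit.
Unset Printing Implicit Defensive.

Import Order.TTheory GRing.Theory Num.Theory.
Import numFieldNormedType.Exports.

Local Open Scope classical_set_scope.
Local Open Scope ring_scope.

(** * Calculus on the line *)

Section Calculus.
Context {R : realType}.
Implicit Types (f g h : R -> R) (a b r t x : R).

Lemma is_deriveMr f g x a b : is_derive x 1 f a -> is_derive x 1 g b ->
  is_derive x 1 (fun t => f t * g t) (a * g x + f x * b).
Proof.
move=> fa gb; apply: (is_derive_eq (is_deriveM fa gb)).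
by rewrite /GRing.scale /= addrC (mulrC a).
Qed.

Lemma is_derive_const x a : is_derive x 1 (fun=> a) 0.
Proof. exact: is_derive_cst. Qed.

Lemma is_deriveDr f g x a b : is_derive x 1 f a -> is_derive x 1 g b ->
  is_derive x 1 (fun t => f t + g t) (a + b).
Proof. by move=> fa gb; exact: is_deriveD. Qed.

Lemma is_deriveBr f g x a b : is_derive x 1 f a -> is_derive x 1 g b ->
  is_derive x 1 (fun t => f t - g t) (a - b).
Proof. by move=> fa gb; exact: is_deriveB. Qed.

Lemma is_derive_expRM r x :
  is_derive x 1 (fun t => expR (r * t)) (r * expR (r * x)).
Proof.
have d : is_derive x 1 (fun t => r * t) r.
  by apply: is_derive_eq; rewrite /GRing.scale /= mulr1.
have := @is_derive1_comp R expR (fun t => r * t) x _ _ (is_derive_expR _) d.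
by rewrite mulrC.
Qed.

Lemma is_derive_sumr n (F : 'I_n -> R -> R) (D : 'I_n -> R) t :
  (forall i, is_derive t 1 (F i) (D i)) ->
  is_derive t 1 (fun x => \sum_(i < n) F i x) (\sum_(i < n) D i).
Proof.
move=> Fd; rewrite (_ : (fun x => _) = \sum_(i < n) F i); last first.
  by apply/funext => x; rewrite fct_sumE.
exact: is_derive_sum.
Qed.

Lemma is_derive_linear a x : is_derive x 1 (fun t => a * t) a.
Proof.
apply: (is_derive_eq (is_deriveMr (is_derive_const x a) (is_derive_id x 1))).
by rewrite mul0r add0r mulr1.
Qed.

Lemma is_derive_sub f x a b : is_derive (a - x) 1 f b ->
  is_derive x 1 (fun t => f (a - t)) (- b).
Proof.
move=> fb; have d : is_derive x 1 (fun t => a - t) (-1).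
  apply: (is_derive_eq (is_deriveB (is_derive_cst a x 1) (is_derive_id x 1))).
  by rewrite sub0r.
have := @is_derive1_comp R f (fun t => a - t) x _ _ fb d.
by rewrite mulrN1.
Qed.

Lemma near_eq_is_derive f g x a : (\forall t \near x, f t = g t) ->
  is_derive x 1 f a -> is_derive x 1 g a.
Proof.
move=> fg [fd fa]; split; first exact: near_eq_derivable fg fd.
by rewrite -fa; apply: near_eq_derive => //; rewrite ?oner_neq0 //; near do symmetry.
Unshelve. all: by end_near. Qed.

Lemma is_derive_continuous f x a : is_derive x 1 f a -> {for x, continuous f}.
Proof. by move=> [fd _]; apply/differentiable_continuous/derivable1_diffP. Qed.

Lemma continuous_expRM r : continuous (fun t => expR (r * t)).
Proof. by move=> x; exact: is_derive_continuous (is_derive_expRM r x). Qed.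

Lemma continuous_mulr f g : continuous f -> continuous g ->
  continuous (fun x => f x * g x).
Proof. by move=> fc gc x; apply: cvgM; [exact: fc|exact: gc]. Qed.

Lemma continuous_addr f g : continuous f -> continuous g ->
  continuous (fun x => f x + g x).
Proof. by move=> fc gc x; apply: cvgD; [exact: fc|exact: gc]. Qed.

Lemma continuous_subr f g : continuous f -> continuous g ->
  continuous (fun x => f x - g x).
Proof. by move=> fc gc x; apply: cvgB; [exact: fc|exact: gc]. Qed.

Lemma continuous_sumr n (F : 'I_n -> R -> R) :
  (forall i, continuous (F i)) -> continuous (fun x => \sum_(i < n) F i x).
Proof.
elim: n F => [|n IH] F Fc.
  by under eq_fun do rewrite big_ord0; move=> x; exact: cvg_cst.
under eq_fun do rewrite big_ord_recr /=.
by apply: continuous_addr => //; exact: IH.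
Qed.
Lemma derive_ge0_ge0 f T : continuous f -> 0 <= f 0 ->
  (forall x, 0 < x < T -> exists2 d, is_derive x 1 f d & 0 <= d) ->
  forall t, 0 <= t <= T -> 0 <= f t.
Proof.
move=> fc f0 fd t /andP[t0 tT]; apply: (le_trans f0).
apply: (@ger0_derive1_ndecr R f 0 T) => //.
- by move=> x; rewrite in_itv => /fd[d [] ? _ _].
- by move=> x; rewrite in_itv => /fd[d [_ <-]]; rewrite derive1E.
- exact: continuous_subspaceT.
Qed.

Lemma is_derive_primitive f a x : continuous f -> a < x ->
  is_derive x 1 (fun u => \int[lebesgue_measure]_(s in `[a, u]) f s) (f x).
Proof.
move=> fc ax.
have xu : x < x + 1 by rewrite ltrDl.
have fi : lebesgue_measure.-integrable `[a, x + 1] (EFin \o f).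
  apply: continuous_compact_integrable; first exact: segment_compact.
  exact: continuous_subspaceT.
have [d1 d2] := @continuous_FTC1 R f (BLeft a) x (x + 1) xu fi ax (fc x).
by apply: DeriveDef; [exact: d1|rewrite -derive1E; exact: d2].
Qed.

Lemma Rintegral_derive f g a b : a < b -> continuous f ->
  (forall x, a <= x <= b -> is_derive x 1 g (f x)) ->
  \int[lebesgue_measure]_(s in `[a, b]) f s = g b - g a.
Proof.
move=> ab fc fg; rewrite /Rintegral (@continuous_FTC2 R f g a b ab) //.
- exact: continuous_subspaceT.
- have gc x : a <= x <= b -> {for x, continuous g}.
    by move=> /fg; exact: is_derive_continuous.
  split.
  + move=> x; rewrite in_itv /= => /andP[? ?].
    by have [] : is_derive x 1 g (f x) by apply: fg; apply/andP; split; exact: ltW.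
  + by apply/cvg_at_right_filter/gc; rewrite lexx ltW.
  + by apply/cvg_at_left_filter/gc; rewrite lexx ltW.
- move=> x; rewrite in_itv /= => /andP[? ?]; rewrite derive1E.
  by have [] : is_derive x 1 g (f x) by apply: fg; apply/andP; split; exact: ltW.
Qed.

End Calculus.

(** Integrating [1 - x <= expR (- x)] once gives the upper side, twice the lower
    one. *)
Lemma expRN_taylor {R : realType} (x : R) : 0 <= x ->
  `|expR (- x) - 1 + x - x ^+ 2 / 2| <= x ^+ 3.
Proof.
move=> x0; have xx : 0 <= x <= x by rewrite x0 lexx.
have dE (y : R) := is_derive_expRM (-1) y.
have EE (y : R) : expR (- y) = expR (-1 * y) by rewrite mulN1r.
have dq (y : R) := is_deriveMr (is_derive_id y 1) (is_derive_id y 1).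
have upper (y : R) : 0 <= y -> 0 <= 1 - y + y * y * 2^-1 - expR (-1 * y).
  move=> y0; have yy : 0 <= y <= y by rewrite y0 lexx.
  apply: (@derive_ge0_ge0 R (fun y => 1 - y + y * y * 2^-1 - expR (-1 * y)) y) => //.
  - have h (z : R) := is_deriveBr (is_deriveDr (is_deriveBr (is_derive_const z 1)
      (is_derive_id z 1)) (is_deriveMr (dq z) (is_derive_const z 2^-1))) (dE z).
    by move=> z; exact: is_derive_continuous (h z).
  - move=> z _.
    have h := is_deriveBr (is_deriveDr (is_deriveBr (is_derive_const z 1)
      (is_derive_id z 1)) (is_deriveMr (dq z) (is_derive_const z 2^-1))) (dE z).
    eexists; first exact: h.
    by have := expR_ge1Dx (-1 * z); rewrite /=; lra.
have lower : 0 <= expR (-1 * x) - 1 + x - x * x * 2^-1 + x * x * x.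
  have h (z : R) := is_deriveDr (is_deriveBr (is_deriveDr (is_deriveBr (dE z)
      (is_derive_const z 1)) (is_derive_id z 1))
      (is_deriveMr (dq z) (is_derive_const z 2^-1)))
      (is_deriveMr (dq z) (is_derive_id z 1)).
  apply: (@derive_ge0_ge0 R
    (fun x => expR (-1 * x) - 1 + x - x * x * 2^-1 + x * x * x) x) => //.
  - by move=> z; exact: is_derive_continuous (h z).
  - move=> z /andP[z0 _]; eexists; first exact: h.
    have := upper z (ltW z0); have := sqr_ge0 z; rewrite /= expr2; lra.
have := upper x x0; have : 0 <= x * x * x by rewrite !mulr_ge0.
rewrite EE ler_norml !exprS expr0 mulr1; move: lower; move: (expR _) => e.
by move=> *; apply/andP; split; lra.
Qed.

(** * Relaxation equations and comparison *)

Section Convolution.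
Context {R : realType}.
Implicit Types (f g h : R -> R) (a b r t x : R).

(** The solution of y' = r (h - y), y 0 = 0, written as in [death_prob]: below the
    diagonal, [death_prob] iterates it along the levels. *)
Definition exp_conv r h t : R :=
  \int[lebesgue_measure]_(s in `[0, t]) (r * expR (- (r * s)) * h (t - s)).

(** The substitution s -> t - s turns the convolution into
    exp(- r t) times a primitive of r exp(r u) h(u). Continuity holds on the
    whole line because the convolution vanishes for t < 0; this is what makes
    the induction over the levels go through. *)
Lemma exp_conv_relaxation r h : continuous h ->
  continuous (exp_conv r h) /\
  forall t, 0 < t -> is_derive t 1 (exp_conv r h) (r * (h t - exp_conv r h t)).
Proof.
move=> hc.
pose phi u := r * expR (r * u) * h u.
have phic : continuous phi.
  apply: continuous_mulr => //; apply: continuous_mulr; last exact: continuous_expRM.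
  by move=> x; exact: cvg_cst.
(* Starting at -1 makes F differentiable at 0 as well. *)
pose F (u : R) : R := \int[lebesgue_measure]_(s in `[-1, u]) phi s.
pose y t := expR (- r * t) * (F t - F 0).
have y0 : y 0 = 0 by rewrite /y subrr mulr0.
have yd t : -1 < t -> is_derive t 1 y (r * (h t - y t)).
  move=> t1; have d1 := is_derive_expRM (- r) t.
  have d2 : is_derive t 1 (fun t => F t - F 0) (phi t).
    rewrite -[phi t]subr0; apply: is_deriveBr; first exact: is_derive_primitive.
  have d3 : is_derive t 1 y _ := is_deriveMr d1 d2.
  apply: (is_derive_eq d3).
  have e1 : expR (- r * t) * expR (r * t) = 1.
    by rewrite -expRD mulNr addNr expR0.
  rewrite /y /phi.
  have -> : expR (- r * t) * (r * expR (r * t) * h t) =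
            (expR (- r * t) * expR (r * t)) * (r * h t) by ring.
  by rewrite e1; ring.
have yc t : -1 < t -> {for t, continuous y}.
  by move=> /yd; exact: is_derive_continuous.
have convE t : exp_conv r h t = y (Num.max 0 t).
  have [t0|t0|<-] := ltgtP 0 t; last 2 first.
  - rewrite y0 /exp_conv set_itv_ge ?Rintegral_set0 //.
    by rewrite bnd_simp -ltNge.
  - by rewrite y0 /exp_conv set_itv1 Rintegral_set1.
  have -> : y t = - (expR (- r * t) * y (t - t)) - - (expR (- r * 0) * y (t - 0)).
    by rewrite subrr y0 mulr0 mulr0 expR0 subr0 mul1r oppr0 sub0r opprK.
  apply: (Rintegral_derive (g := fun s => - (expR (- r * s) * y (t - s)))).
  - exact: t0.
  - apply: continuous_mulr.
      apply: continuous_mulr; first by move=> x; exact: cvg_cst.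
      by under eq_fun do rewrite -mulNr; exact: continuous_expRM.
    move=> x; apply: (continuous_comp (f := fun s => t - s)); last exact: hc.
    by apply: continuous_subr => z; [exact: cvg_cst|exact: cvg_id].
  - move=> x /andP[x0 xt].
    have tx : -1 < t - x by rewrite (@lt_le_trans _ _ 0) ?subr_ge0.
    have d1 := is_derive_expRM (- r) x.
    have d2 := is_derive_sub (yd _ tx).
    have d3 : is_derive x 1 (fun s => - (expR (- r * s) * y (t - s))) _ :=
      is_deriveN (is_deriveMr d1 d2).
    apply: (is_derive_eq d3).
    by rewrite -[- (r * x)]mulNr; ring.
have maxc : continuous (fun t : R => Num.max 0 t).
  by move=> t; apply: continuous_max; [exact: cvg_cst|exact: cvg_id].
split.
  rewrite (_ : exp_conv r h = y \o (fun t => Num.max 0 t)); last first.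
    by apply/funext => t; rewrite convE.
  move=> t; apply: continuous_comp; first exact: maxc.
  by apply: yc; rewrite (@lt_le_trans _ _ 0) // le_max lexx.
move=> t t0; rewrite convE max_r ?ltW //.
apply: (near_eq_is_derive (f := y)); last by apply: yd; rewrite (lt_trans _ t0).
near=> s; rewrite convE max_r // ltW //; near: s; exact: lt_nbhsr.
Unshelve. all: by end_near. Qed.

(** Positivity of a triangular system of differential inequalities: by induction
    on the level, expR (r k * s) * E k s has a nonnegative derivative. *)
Lemma death_comparison (r : nat -> R) (E : nat -> R -> R) (T : R) (N : nat) :
  (forall k, 0 <= r k) ->
  (forall k, (k <= N)%N -> continuous (E k)) ->
  (forall k, (k <= N)%N -> 0 <= E k 0) ->
  (forall k s, (k <= N)%N -> 0 < s < T ->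
     exists2 e, is_derive s 1 (E k) e & r k * (E k.-1 s - E k s) <= e) ->
  forall k s, (k <= N)%N -> 0 <= s <= T -> 0 <= E k s.
Proof.
move=> r0 Ec E0 Ed; elim=> [|k IH] s kN sT.
  apply: (@derive_ge0_ge0 _ (E 0%N) T) => //; [exact: Ec|exact: E0|].
  move=> x xT; have [e de he] := Ed 0%N x kN xT; exists e => //.
  by move: he; rewrite /= subrr mulr0.
suff : 0 <= expR (r k.+1 * s) * E k.+1 s by rewrite pmulr_rge0 // expR_gt0.
apply: (@derive_ge0_ge0 _ (fun s => expR (r k.+1 * s) * E k.+1 s) T) => //.
- by apply: continuous_mulr; [exact: continuous_expRM|exact: Ec].
- by rewrite mulr0 expR0 mul1r; exact: E0.
- move=> x xT; have [e de he] := Ed k.+1 x kN xT.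
  have d1 := is_derive_expRM (r k.+1) x.
  eexists; first exact: is_deriveMr d1 de.
  have -> : r k.+1 * expR (r k.+1 * x) * E k.+1 x + expR (r k.+1 * x) * e =
    expR (r k.+1 * x) * (r k.+1 * E k.+1 x + e) by ring.
  rewrite mulr_ge0 ?expR_ge0 //.
  have h1 : 0 <= r k.+1 * E k x.
    by rewrite mulr_ge0 //; apply: IH; [exact: ltnW|case/andP: xT => *; rewrite !ltW].
  move: he; rewrite /= mulrBr; lra.
Qed.
End Convolution.

(** * The death process and its idle gap *)

Section DeathProcess.
Context {R : realType} (m : nat) (mu : R) (mu_gt0 : 0 < mu).
Implicit Types (k j N : nat) (s t T : R) (f : nat -> R) (U d : nat -> R -> R).

Local Notation c := (mu * m%:R).
Local Notation rate := (death_rate m mu).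

Lemma death_rate_ge0 k : 0 <= rate k.
Proof. by rewrite /death_rate mulr_ge0 ?ler0n // ltW. Qed.

Lemma death_prob_gt k j t : (k < j)%N -> death_prob m mu k j t = 0.
Proof.
elim: k t => [|k IH] t kj /=; first by rewrite gtn_eqF.
rewrite gtn_eqF // (_ : (fun s => _) = fun=> 0).
  by rewrite /Rintegral integral0.
by apply/funext => s; rewrite IH ?mulr0 // ltnW.
Qed.

Lemma death_prob0 k j : death_prob m mu k j 0 = (j == k)%:R.
Proof.
case: k => [|k] //=; have [jk|jk] := eqVneq j k.+1.
  by rewrite mulr0 oppr0 expR0.
by rewrite set_itv1 Rintegral_set1.
Qed.

(** Kolmogorov's backward equation. At level 0 the rate vanishes, so that the
    meaning of [k.-1] does not matter there. *)
Lemma death_prob_backward k j :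
  continuous (death_prob m mu k j) /\
  forall t, 0 < t -> is_derive t 1 (death_prob m mu k j)
    (rate k * (death_prob m mu k.-1 j t - death_prob m mu k j t)).
Proof.
elim: k => [|k [IHc _]].
  split; first by move=> x; exact: cvg_cst.
  by move=> t t0; rewrite subrr mulr0; exact: is_derive_const.
have [->|jk] := eqVneq j k.+1.
  have -> : death_prob m mu k.+1 k.+1 = fun t => expR (- rate k.+1 * t).
    by apply/funext => t; rewrite /= eqxx mulNr.
  split; first exact: continuous_expRM.
  move=> t t0; rewrite death_prob_gt //= sub0r mulrN -mulNr.
  exact: is_derive_expRM.
have -> : death_prob m mu k.+1 j = exp_conv (rate k.+1) (death_prob m mu k j).
  by apply/funext => t; rewrite /= (negbTE jk).
exact: exp_conv_relaxation.
Qed.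

Lemma continuous_death_prob k j : continuous (death_prob m mu k j).
Proof. by case: (death_prob_backward k j). Qed.

Lemma death_prob_ge0_le1 k j t : 0 <= t -> 0 <= death_prob m mu k j t <= 1.
Proof.
move=> t0; have tt : 0 <= t <= t by rewrite t0 lexx.
apply/andP; split.
  apply: (@death_comparison R rate (fun k => death_prob m mu k j) t k) => //.
  - exact: death_rate_ge0.
  - by move=> i _; exact: continuous_death_prob.
  - by move=> i _; rewrite death_prob0 ler0n.
  - move=> i s _ /andP[s0 _]; eexists; last exact: lexx.
    by apply: (death_prob_backward i j).2.
rewrite -subr_ge0.
apply: (@death_comparison R rate (fun k t => 1 - death_prob m mu k j t) t k) => //.
- exact: death_rate_ge0.
- move=> i _; apply: continuous_subr; last exact: continuous_death_prob.
  by move=> x; exact: cvg_cst.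
- by move=> i _; rewrite death_prob0 subr_ge0; case: eqP.
- move=> i s _ /andP[s0 _]; eexists.
    exact: is_deriveBr (is_derive_const s 1) ((death_prob_backward i j).2 _ s0).
  by rewrite le_eqVlt; apply/orP; left; apply/eqP; ring.
Qed.

(** The semigroup of the death process applied to [f]; levels above [N] are never
    reached from [k <= N]. *)
Definition death_mean N f k t : R := \sum_(j < N.+1) death_prob m mu k j t * f j.

Lemma continuous_death_mean N f k : continuous (death_mean N f k).
Proof.
apply: continuous_sumr => i; apply: continuous_mulr.
  exact: continuous_death_prob.
by move=> x; exact: cvg_cst.
Qed.

Lemma death_mean0 N f k : (k <= N)%N -> death_mean N f k 0 = f k.
Proof.
move=> kN; rewrite /death_mean (bigD1 (Ordinal (kN : (k < N.+1)%N))) //=.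
rewrite death_prob0 eqxx mul1r big1 ?addr0 // => i ik.
rewrite death_prob0 (_ : _ == _ = false) ?mul0r //.
by apply: contraNF ik => /eqP ik; apply/eqP/val_inj.
Qed.

Lemma death_mean_backward N f k t : 0 < t ->
  is_derive t 1 (death_mean N f k)
    (rate k * (death_mean N f k.-1 t - death_mean N f k t)).
Proof.
move=> t0; rewrite /death_mean -sumrB mulr_sumr.
apply: is_derive_sumr => i; have d1 := (death_prob_backward k i).2 _ t0.
apply: (is_derive_eq (is_deriveMr d1 (is_derive_const t (f i)))).
by rewrite mulr0 addr0 -mulrBl mulrA.
Qed.

(** [U] solves the backward equation of the death process with constant rate
    mu m, all servers working at every level. The increment [d] is a separate
    parameter because at level 0 it refers to a fictitious level -1. *)
Definition busy_solution U d :=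
  (forall k t, is_derive t 1 (U k) (- (c * d k t))) /\
  (forall k t, d k.+1 t = U k.+1 t - U k t).

(** By Dynkin's formula this is the expected integral of
    (mu m - rate) times the increment of [U], that is, the effect on [U] of the
    services that idle servers fail to deliver. *)
Definition idle_gap N U k t : R := death_mean N (fun j => U j 0) k t - U k t.

Lemma busy_solution_continuous U d k : busy_solution U d -> continuous (U k).
Proof. by move=> [Ud _] x; exact: is_derive_continuous (Ud k x). Qed.

Lemma continuous_idle_gap N U d k : busy_solution U d ->
  continuous (idle_gap N U k).
Proof.
move=> Ud; apply: continuous_subr; first exact: continuous_death_mean.
exact: busy_solution_continuous Ud.
Qed.

Lemma idle_gap0 N U k : (k <= N)%N -> idle_gap N U k 0 = 0.
Proof. by move=> kN; rewrite /idle_gap death_mean0 // subrr. Qed.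

(** The source term vanishes above level m: a gap is created only while some
    server is idle. *)
Lemma idle_gap_backward N U d k t : busy_solution U d -> 0 < t ->
  is_derive t 1 (idle_gap N U k)
    (rate k * (idle_gap N U k.-1 t - idle_gap N U k t) + (c - rate k) * d k t).
Proof.
move=> [Ud dU] t0.
have dm := death_mean_backward N (fun j => U j 0) k t0.
apply: (is_derive_eq (is_deriveBr dm (Ud k t))) => {dm}.
rewrite /idle_gap; case: k => [|k]; last by rewrite /= dU; ring.
by rewrite /death_rate min0n; ring.
Qed.

Lemma death_rate_le k : rate k <= c.
Proof. by rewrite /death_rate ler_pM2l // ler_nat geq_minr. Qed.

(** Only the increments at the levels up to m enter, since the source of
    [idle_gap_backward] vanishes above them. *)
Lemma idle_gap_le N U d U' d' T : busy_solution U d -> busy_solution U' d' ->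
  (forall k s, (k <= m)%N -> 0 <= s <= T -> d k s <= d' k s) ->
  forall k t, (k <= N)%N -> 0 <= t <= T -> idle_gap N U k t <= idle_gap N U' k t.
Proof.
move=> Ud Ud' dd' k t kN tT; rewrite -subr_ge0.
apply: (@death_comparison R rate
  (fun k t => idle_gap N U' k t - idle_gap N U k t) T N) => // {k t kN tT}.
- exact: death_rate_ge0.
- move=> k _; apply: continuous_subr.
    exact: continuous_idle_gap Ud'.
  exact: continuous_idle_gap Ud.
- by move=> k kN; rewrite !idle_gap0 // subrr.
- move=> k s kN /andP[s0 sT]; eexists.
    exact: is_deriveBr (idle_gap_backward N k Ud' s0) (idle_gap_backward N k Ud s0).
  rewrite -subr_ge0 [leRHS](_ : _ = (c - rate k) * (d' k s - d k s)); last by ring.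
  have [km|mk] := leqP k m.
    by rewrite mulr_ge0 // subr_ge0 ?death_rate_le // dd' // !ltW.
  by rewrite /death_rate (minn_idPr _) ?subrr ?mul0r // ltnW.
Qed.

Lemma busy_solutionZ a U d : busy_solution U d ->
  busy_solution (fun k t => a * U k t) (fun k t => a * d k t).
Proof.
move=> [Ud dU]; split=> k t; last by rewrite dU mulrBr.
by apply: (is_derive_eq (is_deriveMr (is_derive_const t a) (Ud k t))); ring.
Qed.

Lemma idle_gapZ N a U k t :
  idle_gap N (fun k t => a * U k t) k t = a * idle_gap N U k t.
Proof.
rewrite /idle_gap /death_mean mulrBr mulr_sumr; congr (_ - _).
by apply: eq_bigr => i _; rewrite mulrCA.
Qed.

Definition lin_sol k t : R := k%:R - c * t.

Lemma lin_sol_busy : busy_solution lin_sol (fun _ _ => 1).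
Proof.
split=> k t; last by rewrite /lin_sol -natr1; ring.
apply: (is_derive_eq (is_deriveBr (is_derive_const t k%:R) (is_derive_linear c t))).
by rewrite sub0r mulr1.
Qed.

(** The expected number of services missed up to time t because of idle
    servers. *)
Definition idle N := idle_gap N lin_sol.

Lemma idle_ge0 N k t : (k <= N)%N -> 0 <= t -> 0 <= idle N k t.
Proof.
move=> kN t0; have b0 : busy_solution (fun _ _ => 0) (fun _ _ => 0).
  by split=> *; rewrite ?subrr // mulr0 oppr0; exact: is_derive_const.
have tt : 0 <= t <= t by rewrite t0 lexx.
have := idle_gap_le b0 lin_sol_busy (fun _ _ _ _ => ler01) kN tt.
by rewrite {1}/idle_gap /death_mean big1 ?subrr // => i _; exact: mulr0.
Qed.

(** At most all the services that m working servers would have completed can be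
    missed. *)
Lemma idle_le N k t : (k <= N)%N -> 0 <= t -> idle N k t <= c * t.
Proof.
move=> kN t0; rewrite -subr_ge0.
apply: (@death_comparison R rate (fun k t => c * t - idle N k t) t N) => //.
- exact: death_rate_ge0.
- move=> i _; apply: continuous_subr; last exact: continuous_idle_gap lin_sol_busy.
  by move=> x; exact: is_derive_continuous (is_derive_linear c x).
- by move=> i iN; rewrite /idle idle_gap0 // mulr0 subrr.
- move=> i s iN /andP[s0 st]; eexists.
    exact: is_deriveBr (is_derive_linear c s) (idle_gap_backward N i lin_sol_busy s0).
  rewrite -/(idle N) -subr_ge0 [leRHS](_ : _ = rate i); last by ring.
  exact: death_rate_ge0.
- by rewrite t0 lexx.
Qed.

(** If D is Poisson of mean c t, this is the mean of (k - D)^2. *)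
Definition quad_sol k t : R := (k%:R - c * t) ^+ 2 + c * t.

Lemma quad_sol_busy : busy_solution quad_sol (fun k t => 2 * (k%:R - c * t) - 1).
Proof.
split=> k t; last by rewrite /quad_sol -natr1; ring.
have d1 := is_deriveBr (is_derive_const t k%:R) (is_derive_linear c t).
have d2 := is_deriveDr (is_deriveMr d1 d1) (is_derive_linear c t).
by apply: (is_derive_eq d2); ring.
Qed.

(** If D is Poisson of mean c t, this is the mean of w^(k - D) with
    w = 1 / (1 - theta): the generator multiplies w^k by - c theta. *)
Definition exp_sol (theta : R) k t : R :=
  (1 - theta)^-1 ^+ k * expR (- (theta * c) * t).

Lemma exp_sol_busy theta : theta != 1 ->
  busy_solution (exp_sol theta) (fun k t => theta * exp_sol theta k t).
Proof.
move=> th1; have th0 : 1 - theta != 0 by rewrite subr_eq0 eq_sym.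
split=> k t; last by rewrite /exp_sol exprS; field.
have d1 := is_deriveMr (is_derive_const t ((1 - theta)^-1 ^+ k))
                      (is_derive_expRM (- (theta * c)) t).
by apply: (is_derive_eq d1); rewrite /exp_sol; ring.
Qed.

Section GapBounds.
Variables (N k : nat) (t : R).
Hypotheses (kN : (k <= N)%N) (t_ge0 : 0 <= t).

Let tt : 0 <= t <= t. Proof. by rewrite t_ge0 lexx. Qed.

Lemma idle_gap_le_idle a U d : busy_solution U d ->
  (forall i s, (i <= m)%N -> 0 <= s <= t -> d i s <= a) ->
  idle_gap N U k t <= a * idle N k t.
Proof.
move=> Ud da; rewrite -idle_gapZ.
apply: (idle_gap_le Ud (busy_solutionZ a lin_sol_busy) _ kN tt).
by move=> i s im st; rewrite mulr1; exact: da.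
Qed.

Lemma idle_le_idle_gap a U d : busy_solution U d ->
  (forall i s, (i <= m)%N -> 0 <= s <= t -> a <= d i s) ->
  a * idle N k t <= idle_gap N U k t.
Proof.
move=> Ud da; rewrite -idle_gapZ.
apply: (idle_gap_le (busy_solutionZ a lin_sol_busy) Ud _ kN tt).
by move=> i s im st; rewrite mulr1; exact: da.
Qed.

(** For k <= m and s <= t the increment 2 (k - c s) - 1 lies between
    - (1 + 2 c t) and 2 m. *)
Lemma quad_gap_bounds :
  - (1 + 2 * (c * t)) * idle N k t <= idle_gap N quad_sol k t
    <= 2 * m%:R * idle N k t.
Proof.
have c0 : 0 <= c by rewrite mulr_ge0 // ltW.
apply/andP; split.
  apply: (idle_le_idle_gap quad_sol_busy) => i s _ /andP[_ st].
  have h1 := ler_wpM2l c0 st; have h2 := ler0n R i; lra.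
apply: (idle_gap_le_idle quad_sol_busy) => i s im /andP[s0 _].
have h1 := mulr_ge0 c0 s0; have h2 : i%:R <= m%:R :> R by rewrite ler_nat.
lra.
Qed.

(** For k <= m and s <= t the increment theta w^k exp(- theta c s) lies between
    theta (1 - theta c t) and theta w^m. *)
Lemma exp_gap_bounds theta : 0 < theta < 1 ->
  theta * (1 - theta * (c * t)) * idle N k t <= idle_gap N (exp_sol theta) k t
    <= theta * (1 - theta)^-1 ^+ m * idle N k t.
Proof.
move=> /andP[th0 th1]; have c0 : 0 <= c by rewrite mulr_ge0 // ltW.
have th : theta != 1 by rewrite lt_eqF.
have w1 : 1 <= (1 - theta)^-1.
  by rewrite invf_ge1 ?subr_gt0 // gerBl ltW.
apply/andP; split.
  apply: (idle_le_idle_gap (exp_sol_busy th)) => i s _ /andP[s0 st].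
  rewrite ler_pM2l // /exp_sol -[leLHS]mul1r.
  have e1 : 1 - theta * (c * t) <= expR (- (theta * c) * s).
    apply: (le_trans _ (expR_ge1Dx _)); rewrite mulNr lerD2l lerN2 -[leLHS]mulrA.
    by rewrite ler_wpM2l ?(ltW th0) // ler_wpM2l.
  apply: (le_trans (y := 1 * expR (- (theta * c) * s))).
    by rewrite !mul1r.
  by rewrite ler_wpM2r ?expR_ge0 // exprn_ege1.
apply: (idle_gap_le_idle (exp_sol_busy th)) => i s im /andP[s0 _].
rewrite [leLHS]/= ler_pM2l // /exp_sol -[leRHS]mulr1; apply: ler_pM.
- by rewrite exprn_ge0 // (le_trans ler01).
- exact: expR_ge0.
- by rewrite ler_weXn2l.
- rewrite -[leRHS]expR0 ler_expR mulNr oppr_le0 mulr_ge0 // mulr_ge0 //.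
  exact: ltW.
Qed.

End GapBounds.

End DeathProcess.

(** * Expectations under the interarrival law *)

Section Expectation.
Context {R : realType} (A : probability (measurableTypeR R) R).
Hypothesis A_nonneg : nonneg_law A.
Implicit Types (g h : R -> R) (a : R).

Definition expect (g : R -> R) : R := \int[A]_(x in `[0, +oo[) g x.
Definition integ (g : R -> R) := A.-integrable `[0, +oo[ (EFin \o g).

Let mD : measurable (`[0, +oo[%classic : set (measurableTypeR R)).
Proof. exact: measurable_itv. Qed.

Lemma law_nonneg : A `[0, +oo[%classic = 1%E.
Proof.
have -> : `[0, +oo[%classic = ~` [set x : R | x < 0].
  by apply/seteqP; split => x /=; rewrite in_itv /= andbT leNgt => /negP.
have mS : measurable ([set x : R | x < 0] : set (measurableTypeR R)).
  rewrite (_ : [set x : R | x < 0] = `]-oo, 0[%classic); last first.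
    by apply/seteqP; split => x /=; rewrite in_itv.
  exact: measurable_itv.
by rewrite probability_setC // A_nonneg sube0.
Qed.

Lemma integ_le g h : continuous g -> integ h ->
  (forall x, 0 <= x -> `|g x| <= h x) -> integ g.
Proof.
move=> gc hi gh; apply: (le_integrable mD _ _ hi).
  apply/measurable_EFinP/measurable_funTS; exact: continuous_measurable_fun.
move=> x; rewrite /= in_itv /= andbT => x0.
by rewrite lee_fin (le_trans (gh x x0)) // ler_norm.
Qed.

Lemma integ_const a : integ (fun=> a).
Proof.
apply/integrableP; split; first exact: measurable_cst.
by rewrite integral_cst // [X in (_ * X)%E]law_nonneg mule1 ltry.
Qed.

Lemma integD g h : integ g -> integ h -> integ (fun x => g x + h x).
Proof. by move=> gi hi; have := integrableD mD gi hi; apply: eq_integrable. Qed.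

Lemma integZ a g : integ g -> integ (fun x => a * g x).
Proof. by move=> gi; have := integrableZl mD a gi; apply: eq_integrable. Qed.

Lemma integB g h : integ g -> integ h -> integ (fun x => g x - h x).
Proof. by move=> gi hi; have := integrableB mD gi hi; apply: eq_integrable. Qed.

Lemma integ_sum n (F : 'I_n -> R -> R) : (forall i, integ (F i)) ->
  integ (fun x => \sum_(i < n) F i x).
Proof.
elim: n F => [|n IH] F Fi.
  by under eq_fun do rewrite big_ord0; exact: integ_const.
by under eq_fun do rewrite big_ord_recr /=; apply: integD => //; exact: IH.
Qed.

Lemma expect_const a : expect (fun=> a) = a.
Proof.
by rewrite /expect Rintegral_cst // [X in fine X]law_nonneg mulr1.
Qed.

Lemma expectD g h : integ g -> integ h ->
  expect (fun x => g x + h x) = expect g + expect h.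
Proof. by move=> gi hi; rewrite /expect RintegralD. Qed.

Lemma expectB g h : integ g -> integ h ->
  expect (fun x => g x - h x) = expect g - expect h.
Proof. by move=> gi hi; rewrite /expect RintegralB. Qed.

Lemma expectZ a g : integ g -> expect (fun x => a * g x) = a * expect g.
Proof. by move=> gi; rewrite /expect RintegralZl. Qed.

Lemma expect_sum n (F : 'I_n -> R -> R) : (forall i, integ (F i)) ->
  expect (fun x => \sum_(i < n) F i x) = \sum_(i < n) expect (F i).
Proof.
elim: n F => [|n IH] F Fi.
  by under eq_fun do rewrite big_ord0; rewrite expect_const big_ord0.
under eq_fun do rewrite big_ord_recr /=.
by rewrite expectD // ?IH // ?big_ord_recr //; exact: integ_sum.
Qed.

Lemma expect_le g h : integ g -> integ h ->
  (forall x, 0 <= x -> g x <= h x) -> expect g <= expect h.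
Proof.
move=> gi hi gh; apply: le_Rintegral => // x; rewrite /= in_itv /= andbT.
exact: gh.
Qed.

Lemma integ_ge0_fin g : continuous g -> (forall x, 0 <= x -> 0 <= g x) ->
  (\int[A]_(x in `[0%R, +oo[) (g x)%:E < +oo)%E -> integ g.
Proof.
move=> gc g0 gi; apply/integrableP; split.
  apply/measurable_EFinP/measurable_funTS; exact: continuous_measurable_fun.
move: gi; congr (_ < _)%E; apply: eq_integral => x.
by rewrite inE /= in_itv /= andbT => x0; rewrite ger0_norm ?g0.
Qed.

Lemma expectE g : integ g -> (\int[A]_(x in `[0%R, +oo[) (g x)%:E)%E = (expect g)%:E.
Proof.
by move=> gi; rewrite /expect /Rintegral fineK //; exact: integrable_fin_num.
Qed.

End Expectation.

(** * Stationary balance equations *)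

Section Balance.
Context {R : realType} (m n : nat) (mu : R) (A : probability (measurableTypeR R) R).
Hypotheses (m_gt0 : (0 < m)%N) (mu_gt0 : 0 < mu) (A_nonneg : nonneg_law A).
Variable M : R.
Hypothesis moment3 : (rho_moment m mu A 3 <= M%:E)%E.
Variable v : 'rV[R]_((m + n).+1).
Hypothesis v_stat : stationary (arrival_chain m n mu A) v.

Local Notation N := (m + n)%N.
Local Notation c := (mu * m%:R).
Local Notation E := (expect A).
Local Notation integ := (integ A).
Local Notation kappa i := (minn i.+1 (m + n)).
Local Notation p := (v 0 ord_max).

Definition scaled_moment k : R := E (fun t => (c * t) ^+ k).
Local Notation e1 := (scaled_moment 1).
Local Notation e2 := (scaled_moment 2).
Local Notation e3 := (scaled_moment 3).

Let c_gt0 : 0 < c. Proof. by rewrite mulr_gt0 // ltr0n. Qed.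

Let ct_ge0 t : 0 <= t -> 0 <= c * t.
Proof. by move=> t0; rewrite mulr_ge0 // ltW. Qed.

Let v_ge0 i : 0 <= v 0 i. Proof. by case: v_stat. Qed.
Let v_sum : \sum_i v 0 i = 1. Proof. by case: v_stat. Qed.

Let v_avg a : \sum_i v 0 i * a = a.
Proof. by rewrite -mulr_suml v_sum mul1r. Qed.

Let ct_cont k : continuous (fun t : R => (c * t) ^+ k).
Proof.
have h : continuous (fun t : R => c * t).
  by move=> x; exact: is_derive_continuous (is_derive_linear c x).
elim: k => [|k IH].
  by under eq_fun do rewrite expr0; move=> x; exact: cvg_cst.
by under eq_fun do rewrite exprS; exact: continuous_mulr.
Qed.

Lemma integ_cube : integ (fun t => (c * t) ^+ 3).
Proof.
apply: integ_ge0_fin; [exact: ct_cont| |exact: le_lt_trans moment3 (ltry _)].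
by move=> t t0; rewrite exprn_ge0 // ct_ge0.
Qed.

Lemma integ_power k : (k <= 3)%N -> integ (fun t => (c * t) ^+ k).
Proof.
move=> k3; apply: (integ_le _ (integD (integ_const A_nonneg 1) integ_cube)).
  exact: ct_cont.
move=> t t0; have := ct_ge0 t0; move: (c * t) => x x0.
rewrite ger0_norm ?exprn_ge0 //.
have [x1|x1] := leP x 1.
  by rewrite ler_wpDr ?exprn_ge0 // exprn_ile1.
by rewrite ler_wpDl // ler_weXn2l // ltW.
Qed.

Let integ_ct : integ (fun t => c * t). Proof. exact: (integ_power (k := 1)). Qed.

Lemma integ_death_prob k j : integ (death_prob m mu k j).
Proof.
apply: (integ_le _ (integ_const A_nonneg 1)); first exact: continuous_death_prob.
move=> t t0; have /andP[h0 h1] := death_prob_ge0_le1 m mu_gt0 k j t0.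
by rewrite ger0_norm.
Qed.

Lemma integ_death_mean (f : nat -> R) k : integ (death_mean m mu N f k).
Proof.
apply: integ_sum => // i; under eq_fun do rewrite mulrC.
by apply: integZ; exact: integ_death_prob.
Qed.

(** The invariance of [v] under the chain, tested against [f]. *)
Lemma stationary_mean (f : nat -> R) :
  \sum_i v 0 i * f i = \sum_i v 0 i * E (death_mean m mu N f (kappa i)).
Proof.
have [_ _ vP] := v_stat.
transitivity (\sum_j (v *m arrival_chain m n mu A) 0 j * f j).
  by rewrite vP.
under eq_bigr => j _ do rewrite mxE mulr_suml.
rewrite exchange_big /=; apply: eq_bigr => i _.
rewrite expect_sum // => [|j]; last first.
  by under eq_fun do rewrite mulrC; apply: integZ; exact: integ_death_prob.
rewrite mulr_sumr; apply: eq_bigr => j _; rewrite mxE -mulrA; congr (_ * _).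
under [RHS]eq_Rintegral do rewrite mulrC.
by rewrite [RHS](expectZ _ (integ_death_prob _ _)) mulrC.
Qed.

Definition mean_gap (U : nat -> R -> R) : R :=
  \sum_i v 0 i * E (idle_gap m mu N U (kappa i)).

Lemma integ_idle_gap U k : integ (U k) -> integ (idle_gap m mu N U k).
Proof. by move=> Ui; apply: integB => //; exact: integ_death_mean. Qed.

(** All states i < N move to i + 1 before the interarrival time starts; the
    correction with factor p accounts for the lost customer at N. *)
Lemma balance (U : nat -> R -> R) : (forall k, integ (U k)) ->
  \sum_i v 0 i * (E (U i.+1) - U i 0) - p * (E (U N.+1) - E (U N)) + mean_gap U = 0.
Proof.
move=> Ui.
have shift (g : nat -> R) : \sum_i v 0 i * g (kappa i) =
    \sum_i v 0 i * g i.+1 - p * (g N.+1 - g N).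
  rewrite !big_ord_recr /= (minn_idPr (leqnSn _)).
  under eq_bigr => i _ do rewrite (minn_idPl (ltn_ord i)).
  ring.
have := stationary_mean (fun i => U i 0).
have -> : \sum_i v 0 i * E (death_mean m mu N (fun i => U i 0) (kappa i)) =
    \sum_i v 0 i * E (U (kappa i)) + mean_gap U.
  rewrite /mean_gap -big_split; apply: eq_bigr => i _ /=.
  rewrite -mulrDr /idle_gap expectB; last exact: Ui.
    by rewrite [in RHS]addrC subrK.
  exact: integ_death_mean.
rewrite (shift (fun k => E (U k))) => h.
under eq_bigr do rewrite mulrBr; rewrite sumrB h; ring.
Qed.

Let kappa_le i : (kappa i <= N)%N. Proof. exact: geq_minr. Qed.

Definition mean_idle := mean_gap (lin_sol m mu).
(** The lower bounds in [quad_gap_bounds] and [exp_gap_bounds] involve the length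
    of the interarrival time, whence this weighted version of [mean_idle]. *)
Definition mean_weighted_idle : R :=
  \sum_i v 0 i * E (fun t => c * t * idle m mu N (kappa i) t).

Let integ_lin k : integ (lin_sol m mu k).
Proof. by apply: integB => //; exact: integ_const. Qed.

(** Flow balance: per interarrival time 1 - p customers are admitted, e1 services
    are offered, and [mean_idle] of these are missed. *)
Lemma mean_idleE : mean_idle = e1 - 1 + p.
Proof.
have := balance integ_lin.
have EU k : E (lin_sol m mu k) = k%:R - e1.
  by rewrite expectB // ?expect_const //; exact: integ_const.
rewrite EU EU -/mean_idle.
have -> : \sum_i v 0 i * (E (lin_sol m mu i.+1) - lin_sol m mu i 0) = 1 - e1.
  rewrite -[RHS]v_avg; apply: eq_bigr => i _.
  by rewrite EU /lin_sol -natr1; ring.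
rewrite -natr1; lra.
Qed.

Let integ_idle k : integ (idle m mu N k).
Proof. exact: integ_idle_gap. Qed.

Let idle_cont k : continuous (idle m mu N k).
Proof. exact: continuous_idle_gap (lin_sol_busy _ _). Qed.

Let integ_widle k : (k <= N)%N -> integ (fun t => c * t * idle m mu N k t).
Proof.
move=> kN; apply: (integ_le _ (integ_power (k := 2) isT)).
  by apply: continuous_mulr => //; exact: (ct_cont (k := 1)).
move=> t t0; have h0 := idle_ge0 m mu_gt0 kN t0.
have h1 := idle_le m mu_gt0 kN t0; have h2 := ct_ge0 t0.
have hn := mulr_ge0 h2 h0; rewrite ger0_norm //.
by rewrite expr2 ler_wpM2l.
Qed.

Lemma sum_expect_le (F G : nat -> R -> R) :
  (forall k, (k <= N)%N -> integ (F k)) -> (forall k, (k <= N)%N -> integ (G k)) ->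
  (forall k t, (k <= N)%N -> 0 <= t -> F k t <= G k t) ->
  \sum_i v 0 i * E (F (kappa i)) <= \sum_i v 0 i * E (G (kappa i)).
Proof.
move=> Fi Gi FG; apply: ler_sum => i _; apply: ler_wpM2l => //.
by apply: expect_le => [||x x0]; [exact: Fi|exact: Gi|exact: FG].
Qed.

Lemma sum_expect_linear a b (F G : nat -> R -> R) :
  (forall k, (k <= N)%N -> integ (F k)) -> (forall k, (k <= N)%N -> integ (G k)) ->
  \sum_i v 0 i * E (fun t => a * F (kappa i) t + b * G (kappa i) t) =
  a * \sum_i v 0 i * E (F (kappa i)) + b * \sum_i v 0 i * E (G (kappa i)).
Proof.
move=> Fi Gi; rewrite !mulr_sumr -big_split; apply: eq_bigr => i _ /=.
have Fk := Fi _ (kappa_le i); have Gk := Gi _ (kappa_le i).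
rewrite expectD ?expectZ //; [ring|exact: integZ|exact: integZ].
Qed.

Lemma mean_weighted_idle_ge0 : 0 <= mean_weighted_idle.
Proof.
apply: sumr_ge0 => i _; apply: mulr_ge0 => //; apply: Rintegral_ge0 => t.
rewrite /= in_itv /= andbT => t0.
by apply: mulr_ge0; [exact: ct_ge0|exact: idle_ge0].
Qed.

(** Truncation of the interarrival time at c t = B: below it the weight is at most
    B, above it c t * idle <= (c t)^2 <= (c t)^3 / B. *)
Lemma mean_weighted_idle_le B : 0 < B ->
  mean_weighted_idle <= B * mean_idle + e3 / B.
Proof.
move=> B0.
have -> : B * mean_idle + e3 / B =
    \sum_i v 0 i * E (fun t => B * idle m mu N (kappa i) t + B^-1 * (c * t) ^+ 3).
  rewrite (@sum_expect_linear B B^-1 (idle m mu N) (fun _ t => (c * t) ^+ 3)) //.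
    by rewrite -mulr_suml v_sum mul1r (mulrC e3).
  by move=> *; exact: integ_cube.
apply: (@sum_expect_le (fun k t => c * t * idle m mu N k t)
  (fun k t => B * idle m mu N k t + B^-1 * (c * t) ^+ 3)) => //.
  by move=> k kN; apply: integD; apply: integZ => //; exact: integ_cube.
move=> k t kN t0; have h0 := idle_ge0 m mu_gt0 kN t0.
have h1 := idle_le m mu_gt0 kN t0; have h2 := ct_ge0 t0.
have [xB|Bx] := leP (c * t) B.
  rewrite ler_wpDr ?ler_wpM2r // mulr_ge0 ?invr_ge0 ?(ltW B0) //.
  exact: exprn_ge0.
rewrite ler_wpDl ?mulr_ge0 ?(ltW B0) // (mulrC B^-1) ler_pdivlMr //.
move: h0 h1 h2 Bx; move: (c * t) (idle _ _ _ _ _) => x y y0 yx x0 Bx.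
by rewrite !exprS expr0 mulr1 -mulrA ler_wpM2l // ler_pM // ltW.
Qed.

Lemma mean_gap_le U U' : (forall k, integ (U k)) -> (forall k, integ (U' k)) ->
  (forall k t, (k <= N)%N -> 0 <= t -> idle_gap m mu N U k t <= U' k t) ->
  mean_gap U <= \sum_i v 0 i * E (U' (kappa i)).
Proof.
move=> Ui Ui' UU'; apply: (@sum_expect_le (idle_gap m mu N U)) => // k _.
exact: integ_idle_gap.
Qed.

Let quadE k : quad_sol m mu k =
  fun t => k%:R ^+ 2 - (2 * k%:R - 1) * (c * t) + (c * t) ^+ 2.
Proof. by apply/funext => t; rewrite /quad_sol; ring. Qed.

Let integ_quad k : integ (quad_sol m mu k).
Proof.
rewrite quadE.
apply: integD; last exact: integ_power.
by apply: integB; [exact: integ_const|exact: integZ].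
Qed.

Let expect_quad k : E (quad_sol m mu k) = k%:R ^+ 2 - (2 * k%:R - 1) * e1 + e2.
Proof.
have i1 : integ (fun=> k%:R ^+ 2) by exact: integ_const.
have i2 : integ (fun t => (2 * k%:R - 1) * (c * t)) by exact: integZ.
have i3 := integ_power (k := 2) isT.
rewrite quadE expectD //; last exact: integB.
by rewrite expectB // expect_const // expectZ.
Qed.

Lemma mean_level_bounds : 0 <= \sum_i v 0 i * i%:R <= N%:R.
Proof.
apply/andP; split; first by apply: sumr_ge0 => i _; rewrite mulr_ge0.
rewrite -[leRHS]v_avg; apply: ler_sum => i _.
by rewrite ler_wpM2l // ler_nat -ltnS.
Qed.

(** The stationarity identity for f(k) = k^2; S is the stationary mean level and
    Q the stationary mean of the idle gap. *)
Lemma quad_balance : exists S Q : R, [/\ 0 <= S <= N%:R,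
  - (mean_idle + 2 * mean_weighted_idle) <= Q <= 2 * m%:R * mean_idle &
  p * (2 * N%:R + 1 - 2 * e1) = 2 * S * (1 - e1) + 1 - e1 + e2 + Q].
Proof.
exists (\sum_i v 0 i * i%:R), (mean_gap (quad_sol m mu)).
split; first exact: mean_level_bounds.
  have -> : - (mean_idle + 2 * mean_weighted_idle) = \sum_i v 0 i *
      E (fun t => -1 * idle m mu N (kappa i) t +
                  -2 * (c * t * idle m mu N (kappa i) t)).
    rewrite (@sum_expect_linear (-1) (-2) (idle m mu N)
      (fun k t => c * t * idle m mu N k t)) // -/mean_weighted_idle.
    by rewrite -[X in -1 * X]/mean_idle; ring.
  have -> : 2 * m%:R * mean_idle = \sum_i v 0 i *
      E (fun t => 2 * m%:R * idle m mu N (kappa i) t + 0 * idle m mu N (kappa i) t).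
    rewrite (@sum_expect_linear (2 * m%:R) 0 (idle m mu N) (idle m mu N)) //.
    by rewrite mul0r addr0.
  apply/andP; split.
    apply: (@sum_expect_le (fun k t => -1 * idle m mu N k t +
                  -2 * (c * t * idle m mu N k t))) => [k kN|k kN|k t kN t0].
    - by apply: integD; apply: integZ => //; exact: integ_widle.
    - exact: integ_idle_gap.
    - have /andP[+ _] := quad_gap_bounds m mu_gt0 kN t0; lra.
  apply: (mean_gap_le (U' := fun k t => 2 * m%:R * idle m mu N k t +
     0 * idle m mu N k t)) => // [k|k t kN t0].
    by apply: integD; apply: integZ.
  have /andP[_] := quad_gap_bounds m mu_gt0 kN t0; lra.
have := balance integ_quad.
have -> : \sum_i v 0 i * (E (quad_sol m mu i.+1) - quad_sol m mu i 0) =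
   2 * (\sum_i v 0 i * i%:R) * (1 - e1) + (1 - e1 + e2).
  rewrite -[1 - e1 + e2]v_avg mulr_sumr mulr_suml -big_split.
  apply: eq_bigr => i _; rewrite expect_quad /quad_sol -natr1 /=; ring.
rewrite !expect_quad -natr1; lra.
Qed.

(** The stationarity identity for f(k) = w^k. Here alpha is the Laplace transform of
    the interarrival law at theta c, W the stationary mean of w^k and X that of the
    idle gap; w alpha - 1 is of order theta^2 when theta is close to
    2 (e1 - 1) / e2. *)
Lemma exp_balance theta : 0 < theta < 1 ->
  exists alpha W X : R, let w := (1 - theta)^-1 in
  [/\ `|alpha - 1 + theta * e1 - theta ^+ 2 * e2 / 2| <= theta ^+ 3 * e3,
      1 <= W <= w ^+ N,
      theta * mean_idle - theta ^+ 2 * mean_weighted_idle <= X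
        <= theta * w ^+ m * mean_idle &
      p * w ^+ N * (w - 1) * alpha = (w * alpha - 1) * W + X].
Proof.
move=> th; have /andP[th0 th1] := th; set w := (1 - theta)^-1.
have w1 : 1 <= w by rewrite invf_ge1 ?subr_gt0 // gerBl ltW.
pose e t := expR (- (theta * c) * t).
have ei : integ e.
  apply: (integ_le _ (integ_const A_nonneg 1)); first exact: continuous_expRM.
  move=> t t0; rewrite ger0_norm ?expR_ge0 // -expR0 ler_expR mulNr oppr_le0.
  by rewrite -mulrA mulr_ge0 ?ct_ge0 // ltW.
have Ui k : integ (exp_sol m mu theta k) by exact: integZ.
have EU k : E (exp_sol m mu theta k) = w ^+ k * E e by exact: expectZ.
exists (E e), (\sum_i v 0 i * w ^+ i), (mean_gap (exp_sol m mu theta)).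
split.
- have i1 : integ (fun t => theta * (c * t)) by exact: integZ.
  have i2 : integ (fun t => (theta ^+ 2 / 2) * (c * t) ^+ 2).
    by apply: integZ; exact: integ_power.
  have i3 : integ (fun t => theta ^+ 3 * (c * t) ^+ 3).
    by apply: integZ; exact: integ_cube.
  have j0 := integ_const A_nonneg 1.
  have j1 := integB ei j0.
  have j2 := integD j1 i1.
  pose g t := e t - 1 + theta * (c * t) - (theta ^+ 2 / 2) * (c * t) ^+ 2.
  have gi : integ g := integB j2 i2.
  have -> : E e - 1 + theta * e1 - theta ^+ 2 * e2 / 2 = E g.
    rewrite (expectB j2 i2) (expectD j1 i1) (expectB ei j0) expect_const //.
    rewrite (expectZ _ integ_ct) (expectZ _ (integ_power (k := 2) isT)).
    by rewrite mulrAC.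
  rewrite -(expectZ _ integ_cube) ler_norml -mulN1r -expectZ //.
  have gb t : 0 <= t -> `|g t| <= theta ^+ 3 * (c * t) ^+ 3.
    move=> t0; have := expRN_taylor (mulr_ge0 (ltW th0) (ct_ge0 t0)).
    rewrite /g /e.
    have -> : - (theta * c) * t = - (theta * (c * t)) by ring.
    move: (c * t) => x; rewrite !exprMn (_ : theta ^+ 2 / 2 * x ^+ 2 =
      theta ^+ 2 * x ^+ 2 / 2) //; ring.
  apply/andP; split; apply: expect_le => //; first exact: integZ.
    by move=> t /gb; rewrite ler_norml mulN1r => /andP[].
  by move=> t /gb; rewrite ler_norml => /andP[].
- apply/andP; split.
    rewrite -[leLHS]v_sum; apply: ler_sum => i _.
    by rewrite -[leLHS]mulr1 ler_wpM2l // exprn_ege1.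
  rewrite -[leRHS]v_avg; apply: ler_sum => i _.
  by rewrite ler_wpM2l // ler_weXn2l // -ltnS.
- have -> : theta * mean_idle - theta ^+ 2 * mean_weighted_idle =
     \sum_i v 0 i * E (fun t => theta * idle m mu N (kappa i) t +
                  - theta ^+ 2 * (c * t * idle m mu N (kappa i) t)).
    by rewrite (@sum_expect_linear theta (- theta ^+ 2) (idle m mu N)
      (fun k t => c * t * idle m mu N k t)) // mulNr.
  have -> : theta * w ^+ m * mean_idle = \sum_i v 0 i *
      E (fun t => theta * w ^+ m * idle m mu N (kappa i) t +
                  0 * idle m mu N (kappa i) t).
    rewrite (@sum_expect_linear (theta * w ^+ m) 0 (idle m mu N) (idle m mu N)) //.
    by rewrite mul0r addr0.
  apply/andP; split.
    apply: (@sum_expect_le (fun k t => theta * idle m mu N k t +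
          - theta ^+ 2 * (c * t * idle m mu N k t))) => [k kN|k kN|k t kN t0].
    + by apply: integD; apply: integZ => //; exact: integ_widle.
    + exact: integ_idle_gap.
    + have /andP[+ _] := exp_gap_bounds m mu_gt0 kN t0 th.
      by apply: le_trans; rewrite le_eqVlt; apply/orP; left; apply/eqP; ring.
  apply: (mean_gap_le (U' := fun k t => theta * w ^+ m * idle m mu N k t +
     0 * idle m mu N k t)) => // [k|k t kN t0].
    by apply: integD; apply: integZ.
  have /andP[_ +] := exp_gap_bounds m mu_gt0 kN t0 th.
  by rewrite mul0r addr0.
- have := balance Ui.
  have -> : \sum_i v 0 i * (E (exp_sol m mu theta i.+1) - exp_sol m mu theta i 0) =
      (w * E e - 1) * \sum_i v 0 i * w ^+ i.
    rewrite mulr_sumr; apply: eq_bigr => i _.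
    by rewrite EU /exp_sol mulr0 expR0 exprS -/w; ring.
  rewrite !EU exprS => /eqP; rewrite addrAC subr_eq0 => /eqP ->; ring.
Qed.

End Balance.

(** * Explicit estimates of the loss probability *)

Section Estimates.
Context {R : realType} (m n : nat) (mu : R) (A : probability (measurableTypeR R) R).
Hypotheses (m_gt0 : (0 < m)%N) (mu_gt0 : 0 < mu) (A_nonneg : nonneg_law A).
Variable M : R.
Hypothesis moment3 : (rho_moment m mu A 3 <= M%:E)%E.
Variable p : R.
Hypothesis p_loss : is_loss_probability m n mu A p.

Local Notation N := (m + n)%N.
Local Notation e1 := (scaled_moment m mu A 1).
Local Notation e2 := (scaled_moment m mu A 2).
Local Notation e3 := (scaled_moment m mu A 3).
Local Notation L := (e1 - 1 + p).

Hypothesis e1_gt1 : 1 < e1.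

Lemma loss_probability_bounds : 0 <= p <= 1.
Proof.
have [v [v0 v1 _] ->] := p_loss; rewrite v0 -v1 (bigD1 ord_max) //=.
by rewrite ler_wpDr // sumr_ge0.
Qed.

Let M_ge : 0 <= e3 <= M.
Proof.
apply/andP; split.
  apply: Rintegral_ge0 => t; rewrite /= in_itv /= andbT => t0.
  by rewrite exprn_ge0 // mulr_ge0 // mulr_ge0 // ltW.
by rewrite -lee_fin -expectE //; exact: integ_cube moment3.
Qed.

(** The second moment of c t - 1 is nonnegative. In the limit this keeps rho2 away
    from 0. *)
Lemma scaled_moment2_ge : 2 * e1 - 1 <= e2.
Proof.
have i1 := integ_power m_gt0 mu_gt0 A_nonneg moment3 (k := 1) isT.
have i2 := integ_power m_gt0 mu_gt0 A_nonneg moment3 (k := 2) isT.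
rewrite -subr_ge0.
have <- : expect A (fun t => (mu * m%:R * t) ^+ 2 - 2 * (mu * m%:R * t) ^+ 1 + 1)
   = e2 - (2 * e1 - 1).
  have j := integB i2 (integZ 2 i1).
  rewrite (expectD j (integ_const A_nonneg 1)) (expectB i2 (integZ 2 i1)).
  by rewrite (expectZ _ i1) expect_const // /scaled_moment; ring.
apply: Rintegral_ge0 => t _; move: (mu * m%:R * t) => x.
by have := sqr_ge0 (x - 1); rewrite expr1; lra.
Qed.

Lemma mean_weighted_idle_sqrt (L1 : R) :
  (forall B, 0 < B -> L1 <= B * L + e3 / B) -> L1 <= (1 + M) * Num.sqrt L.
Proof.
have /andP[p0 _] := loss_probability_bounds; have /andP[_ eM] := M_ge.
move=> LB; have L0 : 0 < L by rewrite ltr_wpDr // subr_gt0.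
have s0 : 0 < Num.sqrt L by rewrite sqrtr_gt0.
(* With B = 1 / sqrt L both terms of the bound are of order sqrt L. *)
have := LB (Num.sqrt L)^-1; rewrite invr_gt0 => /(_ s0).
rewrite -{2}(sqr_sqrtr (ltW L0)) expr2 mulKf ?gt_eqF // invrK => /le_trans; apply.
by rewrite mulrDl mul1r lerD2l ler_wpM2r // ltW.
Qed.

(** The drift term 2 S (1 - e1) of [quad_balance], which may be as large as n eps,
    is negative and drops out of the upper bound. *)
Lemma loss_quad_upper : p * (2 * N%:R + 1 - 2 * e1) <= e2 + 2 * m%:R * L.
Proof.
have [v st pE] := p_loss.
have [S [Q [/andP[S0 _] /andP[_ Qu]]]] :=
  quad_balance m_gt0 mu_gt0 A_nonneg moment3 st.
rewrite -pE => ->; move: Qu; rewrite (mean_idleE m_gt0 mu_gt0 A_nonneg moment3 st) -pE.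
have : 0 <= S * (e1 - 1) by rewrite mulr_ge0 // subr_ge0 ltW.
by move: e1_gt1; lra.
Qed.

Lemma loss_quad_estimate :
  `|p * (2 * N%:R + 1 - 2 * e1) - e2| <=
  (2 * N%:R + 1) * (e1 - 1) + (2 * m%:R + 1) * L + 2 * (1 + M) * Num.sqrt L.
Proof.
have [v st pE] := p_loss.
have LE := mean_idleE m_gt0 mu_gt0 A_nonneg moment3 st; rewrite -pE in LE.
have L1u B := mean_weighted_idle_le m_gt0 mu_gt0 A_nonneg moment3 st (B := B).
have L10 := mean_weighted_idle_ge0 m_gt0 mu_gt0 st.
rewrite LE in L1u; have := mean_weighted_idle_sqrt L1u; move: L10.
have [S [Q [/andP[S0 SN] /andP[Ql Qu]]]] :=
  quad_balance m_gt0 mu_gt0 A_nonneg moment3 st.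
rewrite -pE => ->; move: Ql Qu; rewrite LE.
set s := Num.sqrt L; move: (mean_weighted_idle _ _ _) => L1 Ql Qu L10 L1s.
have /andP[p0 _] := loss_probability_bounds.
have SN0 : 0 <= S * (e1 - 1) by rewrite mulr_ge0 // subr_ge0 ltW.
have SN1 : S * (e1 - 1) <= N%:R * (e1 - 1) by rewrite ler_wpM2r // subr_ge0 ltW.
have L0 : 0 <= L by rewrite addr_ge0 // subr_ge0 ltW.
have mL : 0 <= m%:R * L by rewrite mulr_ge0.
move: e1_gt1 SN0 SN1 L0 mL Ql Qu L1s; rewrite /s => {s}.
move: (Num.sqrt _) => s; move: e1 e2 => a b *.
by rewrite ler_norml; apply/andP; split; lra.
Qed.

(** [exp_balance] divided by theta, with W and alpha eliminated: W <= w^N, and alpha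
    differs from 1 - theta by at most theta times the bracket on the right. *)
Lemma loss_exp_estimate (theta w : R) : 0 < theta < 1 -> w = (1 - theta)^-1 ->
  `|p * (w ^+ N - 1) - (e1 - 1)| <=
  2 * w ^+ N.+1 * (`|theta * e2 / 2 - (e1 - 1)| + theta ^+ 2 * M)
  + (w ^+ m - 1) * L + theta * ((1 + M) * Num.sqrt L).
Proof.
move=> th wE; have /andP[th0 th1] := th.
have [v st pE] := p_loss.
have LE := mean_idleE m_gt0 mu_gt0 A_nonneg moment3 st; rewrite -pE in LE.
have L1u B := mean_weighted_idle_le m_gt0 mu_gt0 A_nonneg moment3 st (B := B).
rewrite LE in L1u; have := mean_weighted_idle_sqrt L1u.
have [alpha [W [X]]] := exp_balance m_gt0 mu_gt0 A_nonneg moment3 st th.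
rewrite /= -wE -pE LE; move: (mean_weighted_idle _ _ _) => L1 [ha hW hX hb] L1s.
have /andP[p0 p1] := loss_probability_bounds; have /andP[e30 e3M] := M_ge.
have wth : w - 1 = theta * w by rewrite wE; field; rewrite subr_eq0 gt_eqF.
have w1 : 1 <= w by rewrite wE invf_ge1 ?subr_gt0 // gerBl ltW.
have w0 : 0 <= w by exact: le_trans ler01 w1.
have w1th : w * (1 - theta) = 1 by rewrite wE mulVf // subr_eq0 gt_eqF.
pose eta : R := `|theta * e2 / 2 - (e1 - 1)| + theta ^+ 2 * M.
(* alpha = 1 - theta + beta *)
pose beta := alpha - 1 + theta.
have hbeta : `|beta| <= theta * eta.
  have -> : beta = theta * (theta * e2 / 2 - (e1 - 1)) +
     (alpha - 1 + theta * e1 - theta ^+ 2 * e2 / 2) by rewrite /beta; ring.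
  apply: (le_trans (ler_normD _ _)); rewrite /eta [leRHS]mulrDr lerD //.
    by rewrite normrM gtr0_norm.
  apply: (le_trans ha); rewrite mulrA -exprS ler_wpM2l // exprn_ge0 //; exact: ltW.
have eta0 : 0 <= eta.
  by rewrite addr_ge0 // mulr_ge0 ?sqr_ge0 // (le_trans e30).
pose V : R := w ^+ N; have V0 : 0 <= V by rewrite exprn_ge0.
have alphaE : alpha = 1 - theta + beta by rewrite /beta; ring.
have waE : w * alpha - 1 = w * beta.
  by rewrite alphaE mulrDr w1th; ring.
have key : theta * (p * (V - 1) - (e1 - 1)) =
    w * beta * W + (X - theta * L) - theta * (p * (w * V) * beta).
  have -> : X = p * V * (theta * w) * alpha - w * beta * W.
    by rewrite -wth -waE hb; ring.
  rewrite alphaE; transitivity (theta * (p * (V * (w * (1 - theta)) - 1) - (e1 - 1))).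
    by rewrite w1th mulr1.
  ring.
rewrite -(ler_pM2l th0) -[X in X * `|_|](gtr0_norm th0) -normrM key.
(* The drift term, the idle term and the replacement of w alpha by 1. *)
have t1 : `|w * beta * W| <= theta * (w * V * eta).
  have W0 : 0 <= W by case/andP: hW => /(le_trans ler01).
  rewrite !normrM (ger0_norm W0) (ger0_norm w0).
  have -> : theta * (w * V * eta) = w * (theta * eta) * V by ring.
  apply: ler_pM => //; last by case/andP: hW.
    exact: mulr_ge0.
  exact: ler_wpM2l.
have t2 : `|X - theta * L| <=
    theta * ((w ^+ m - 1) * L + theta * ((1 + M) * Num.sqrt L)).
  have h : theta ^+ 2 * L1 <= theta ^+ 2 * ((1 + M) * Num.sqrt L).
    by rewrite ler_wpM2l // sqr_ge0.
  have L0 : 0 <= L by rewrite addr_ge0 // subr_ge0 ltW.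
  have h1 : 0 <= theta * (w ^+ m - 1) * L.
    by rewrite mulr_ge0 // mulr_ge0 ?(ltW th0) // subr_ge0 exprn_ege1.
  have h2 : 0 <= theta ^+ 2 * ((1 + M) * Num.sqrt L).
    by rewrite mulr_ge0 ?sqr_ge0 // mulr_ge0 // addr_ge0 // (le_trans e30).
  have /andP[Xl Xu] := hX.
  move: h h1 h2 Xl Xu; set a := (1 + M) * Num.sqrt L.
  move: a L => a l; rewrite ler_norml => *; apply/andP; split; lra.
have t3 : `|theta * (p * (w * V) * beta)| <= theta * (w * V * eta).
  rewrite normrM gtr0_norm // ler_pM2l // normrM.
  have wV : 0 <= w * V by exact: mulr_ge0.
  rewrite ger0_norm ?mulr_ge0 //.
  have b1 : `|beta| <= eta.
    by rewrite (le_trans hbeta) // ler_piMl // ltW.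
  apply: ler_pM => //; first exact: mulr_ge0.
  by rewrite ler_piMl.
rewrite exprS -/V -/eta.
apply: (le_trans (ler_normB _ _)); apply: (le_trans (lerD (ler_normD _ _) (lexx _))).
move: t1 t2 t3; move: (`|_ * W|) (`|X - _|) (`|theta * _|) => a b d.
by lra.
Qed.

End Estimates.

(** * Limits *)

Section Asymptotics.
Context {R : realType}.
Implicit Types (u w x : nat -> R) (a b l : R).

Lemma cvg0_le u r : (\forall n \near \oo, `|u n| <= r n) ->
  r n @[n --> \oo] --> (0 : R) -> u n @[n --> \oo] --> (0 : R).
Proof.
move=> ur r0; apply: (squeeze_cvgr (f := fun n => - r n) (h := r)) => //.
  by near=> n; rewrite -ler_norml; near: n.
by rewrite -oppr0; apply: cvgN.
Unshelve. all: by end_near. Qed.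

Lemma cvg_eq u w l : (\forall n \near \oo, w n = u n) ->
  u n @[n --> \oo] --> l -> w n @[n --> \oo] --> l.
Proof.
by move=> uw ul; apply: cvg_trans ul; apply: near_eq_cvg; near do symmetry.
Unshelve. all: by end_near. Qed.

Lemma cvg_sqrt0 u : u n @[n --> \oo] --> (0 : R) ->
  Num.sqrt (u n) @[n --> \oo] --> (0 : R).
Proof.
move=> u0; rewrite -[X in _ --> X]sqrtr0.
by apply: (continuous_cvg _ _ u0); exact: sqrt_continuous.
Qed.

Lemma expR_le_invB (t : R) : 0 < t < 1 ->
  expR t <= (1 - t)^-1 <= expR (t * (1 - t)^-1).
Proof.
move=> /andP[t0 t1]; have h : 0 < 1 - t by rewrite subr_gt0.
apply/andP; split.
  rewrite -[leLHS]invrK lef_pV2 ?posrE ?invr_gt0 ?expR_gt0 //.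
  by rewrite -expRN; exact: expR_ge1Dx.
apply: le_trans (expR_ge1Dx _).
rewrite le_eqVlt; apply/orP; left; apply/eqP; field; exact: lt0r_neq0.
Qed.

(** Both bounds of [expR_le_invB] have the limit expR a at the power k n. *)
Lemma cvg_invB_expn (theta : nat -> R) (k : nat -> nat) a :
  (forall n, 0 < theta n) -> theta n @[n --> \oo] --> (0 : R) ->
  (theta n * (k n)%:R) @[n --> \oo] --> a ->
  ((1 - theta n)^-1 ^+ k n) @[n --> \oo] --> expR a.
Proof.
move=> th0 thc thk.
have w1 : (1 - theta n)^-1 @[n --> \oo] --> (1 : R).
  rewrite -[X in _ --> X]invr1; apply: cvgV; first exact: oner_neq0.
  rewrite -[X in _ --> X]subr0; apply: cvgB => //; exact: cvg_cst.
have ec : continuous (@expR R) by exact: continuous_expR.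
apply: (squeeze_cvgr (f := fun n => expR (theta n * (k n)%:R))
  (h := fun n => expR (theta n * (k n)%:R * (1 - theta n)^-1))).
- near=> n.
  have thn : 0 < theta n < 1.
    by rewrite th0; near: n; apply: (cvgr_lt _ thc); exact: ltr01.
  have /andP[lo hi] := expR_le_invB thn.
  have w0 : 0 <= (1 - theta n)^-1 by rewrite (le_trans _ lo) // expR_ge0.
  have -> : theta n * (k n)%:R = (k n)%:R * theta n by rewrite mulrC.
  rewrite -mulrA !expRM_natl.
  by rewrite !lerXn2r ?nnegrE ?expR_ge0.
- by apply: (continuous_cvg _ _ thk); exact: ec.
- have h : (theta n * (k n)%:R * (1 - theta n)^-1) @[n --> \oo] --> a.
    by rewrite -[X in _ --> X]mulr1; exact: cvgM.
  by apply: (continuous_cvg _ _ h); exact: ec.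
Unshelve. all: by end_near. Qed.

End Asymptotics.

Section LossLimits.
Context {R : realType} (m : nat) (p eps e2 : nat -> R) (M C rho2 : R).
Local Notation N n := (m + n)%N.
Local Notation e1 n := ((1 - eps n)^-1).
Local Notation L n := (e1 n - 1 + p n).
Hypotheses (p01 : forall n, 0 <= p n <= 1)
  (eps01 : forall n, 0 < eps n < 1)
  (eps_cvg : eps n @[n --> \oo] --> (0 : R))
  (epsn_cvg : eps n * n%:R @[n --> \oo] --> C)
  (e2_cvg : e2 n @[n --> \oo] --> rho2)
  (e2_ge : forall n, 2 * e1 n - 1 <= e2 n)
  (quad_upper : forall n,
    p n * (2 * (N n)%:R + 1 - 2 * e1 n) <= e2 n + 2 * m%:R * L n)
  (quad_estimate : forall n,
    `|p n * (2 * (N n)%:R + 1 - 2 * e1 n) - e2 n| <=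
    (2 * (N n)%:R + 1) * (e1 n - 1) + (2 * m%:R + 1) * L n
    + 2 * (1 + M) * Num.sqrt (L n))
  (exp_estimate : forall n (theta w : R), 0 < theta < 1 -> w = (1 - theta)^-1 ->
    `|p n * (w ^+ N n - 1) - (e1 n - 1)| <=
    2 * w ^+ (N n).+1 * (`|theta * e2 n / 2 - (e1 n - 1)| + theta ^+ 2 * M)
    + (w ^+ m - 1) * L n + theta * ((1 + M) * Num.sqrt (L n))).

Local Notation d n := (e1 n - 1).

Lemma excessE n : d n = eps n * e1 n.
Proof. by field; have /andP[_ h] := eps01 n; rewrite subr_eq0 gt_eqF. Qed.

Lemma cvg_e1 : e1 n @[n --> \oo] --> (1 : R).
Proof.
rewrite -[X in _ --> X]invr1; apply: cvgV; first exact: oner_neq0.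
rewrite -[X in _ --> X]subr0; apply: cvgB => //; exact: cvg_cst.
Qed.

Lemma cvg_excess : d n @[n --> \oo] --> (0 : R).
Proof.
by rewrite -(subrr (1 : R)); apply: cvgB; [exact: cvg_e1|exact: cvg_cst].
Qed.

Lemma rho2_ge1 : 1 <= rho2.
Proof.
have h : 2 * e1 n - 1 @[n --> \oo] --> (2 * 1 - 1 : R).
  by apply: cvgB; [apply: cvgM; [exact: cvg_cst|exact: cvg_e1]|exact: cvg_cst].
have hh : (2 * 1 - 1 : R) <= rho2 by apply: ler_cvg_to h e2_cvg _; exact: nearW.
lra.
Qed.

(** From [quad_upper]: its left side is at least p n once n >= 3 and e1 <= 2, and
    the part 2 m p of its right side is absorbed on the left since N = m + n. *)
Lemma loss_bounded : \forall n \near \oo, p n * n%:R <= rho2 + 2.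
Proof.
have h : e2 n + 2 * m%:R * d n @[n --> \oo] --> rho2.
  rewrite -[X in _ --> X]addr0 -(mulr0 (2 * m%:R)); apply: cvgD => //.
  by apply: cvgM; [exact: cvg_cst|exact: cvg_excess].
near=> n; have /andP[p0 p1] := p01 n.
have h1 : e2 n + 2 * m%:R * d n <= rho2 + 2.
  by apply: ltW; near: n; apply: (cvgr_lt _ h); lra.
have h2 : e1 n <= 2.
  by apply: ltW; near: n; apply: (cvgr_lt _ cvg_e1); lra.
have h3 : (3 : R) <= n%:R.
  by rewrite ler_nat; near: n; exact: nbhs_infty_ge.
apply: le_trans h1; have := quad_upper n; rewrite natrD.
have : p n * n%:R <= p n * (2 * n%:R + 1 - 2 * e1 n).
  by rewrite ler_wpM2l //; lra.
move: (m%:R : R) (n%:R : R) h2 => a b h2; move: (e1 n) => c; lra.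
Unshelve. all: by end_near. Qed.

Lemma cvg_loss0 : p n @[n --> \oo] --> (0 : R).
Proof.
apply: (cvg0_le (r := fun n => (rho2 + 2) * n%:R^-1)).
  near=> n; have /andP[p0 p1] := p01 n; rewrite ger0_norm //.
  have n0 : (0 : R) < n%:R by rewrite ltr0n; near: n; exact: nbhs_infty_gt.
  by rewrite ler_pdivlMr //; near: n; exact: loss_bounded.
rewrite -(mulr0 (rho2 + 2)); apply: cvgM; first exact: cvg_cst.
apply/gtr0_cvgV0; last by apply: cvgr_idn.
by near=> n; rewrite ltr0n; near: n; exact: nbhs_infty_gt.
Unshelve. all: by end_near. Qed.

Lemma cvg_L : L n @[n --> \oo] --> (0 : R).
Proof.
by rewrite -(addr0 (0 : R)); apply: cvgD; [exact: cvg_excess|exact: cvg_loss0].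
Qed.

(** n (e1 - 1) tends to 0, so every error term of [quad_estimate] does. *)
Lemma cvg_loss_null : C = 0 -> p n * n%:R @[n --> \oo] --> rho2 / 2.
Proof.
move=> C0; have nd : n%:R * d n @[n --> \oo] --> (0 : R).
  apply: (cvg_eq (u := fun n => eps n * n%:R * e1 n)).
    by near=> n; rewrite excessE; ring.
  by rewrite -(mulr1 (0 : R)) -{1}C0; apply: cvgM => //; exact: cvg_e1.
have h : p n * (2 * (N n)%:R + 1 - 2 * e1 n) - e2 n @[n --> \oo] --> (0 : R).
  apply: (cvg0_le (r := fun n => 2 * (n%:R * d n) + (2 * m%:R + 1) * d n
    + (2 * m%:R + 1) * L n + 2 * (1 + M) * Num.sqrt (L n))).
    near=> n; apply: (le_trans (quad_estimate n)); rewrite natrD.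
    by rewrite le_eqVlt; apply/orP; left; apply/eqP; ring.
  have -> : (0 : R) = 2 * 0 + (2 * m%:R + 1) * 0 + (2 * m%:R + 1) * 0 +
    2 * (1 + M) * 0 by rewrite !mulr0 !addr0.
  apply: cvgD; last first.
    by apply: cvgM; [exact: cvg_cst|exact: cvg_sqrt0 cvg_L].
  apply: cvgD; last by apply: cvgM; [exact: cvg_cst|exact: cvg_L].
  apply: cvgD; last by apply: cvgM; [exact: cvg_cst|exact: cvg_excess].
  by apply: cvgM => //; exact: cvg_cst.
have h2 : p n * (2 * e1 n - 1 - 2 * m%:R) @[n --> \oo] --> (0 : R).
  rewrite -(mul0r (2 * 1 - 1 - 2 * m%:R : R)); apply: cvgM; first exact: cvg_loss0.
  apply: cvgB; last exact: cvg_cst.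
  by apply: cvgB; [apply: cvgM; [exact: cvg_cst|exact: cvg_e1]|exact: cvg_cst].
apply: (cvg_eq (u := fun n => (p n * (2 * (N n)%:R + 1 - 2 * e1 n) - e2 n
    + e2 n + p n * (2 * e1 n - 1 - 2 * m%:R)) * 2^-1)).
  by near=> n; rewrite natrD; move: (e1 n) => x; field.
rewrite -[rho2]addr0 -[X in X + 0]add0r.
by apply: cvgM; [apply: cvgD => //; exact: cvgD|exact: cvg_cst].
Unshelve. all: by end_near. Qed.

(** With theta = 2 eps / rho2, [exp_estimate] divided by theta says that
    (p / theta) (w^N - 1) - (e1 - 1) / theta tends to 0, where (e1 - 1) / theta
    tends to rho2 / 2 and w^N to expR (2 C / rho2). *)
Lemma cvg_loss_pos : 0 < C ->
  p n / eps n @[n --> \oo] --> (expR (2 * C / rho2) - 1)^-1.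
Proof.
move=> C0; have r1 := rho2_ge1; have r0 : 0 < rho2 by rewrite (lt_le_trans ltr01).
have eps0 n : 0 < eps n by case/andP: (eps01 n).
pose k : R := 2 / rho2; have k0 : 0 < k by rewrite divr_gt0.
pose th n := eps n * k.
have th0 n : 0 < th n by rewrite mulr_gt0.
have thc : th n @[n --> \oo] --> (0 : R).
  by rewrite -(mul0r k); apply: cvgM => //; exact: cvg_cst.
pose w n := (1 - th n)^-1.
pose a := 2 * C / rho2.
have thn : th n * n%:R @[n --> \oo] --> a.
  rewrite (_ : a = C * k); last by rewrite /a /k; ring.
  apply: (cvg_eq (u := fun n => eps n * n%:R * k)).
    by near=> n; rewrite /th; ring.
  by apply: cvgM => //; exact: cvg_cst.
have thm j : th n * j%:R @[n --> \oo] --> (0 : R).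
  by rewrite -(mul0r (j%:R : R)); apply: cvgM => //; exact: cvg_cst.
have wN : w n ^+ N n @[n --> \oo] --> expR a.
  apply: cvg_invB_expn => //; rewrite -[X in _ --> X]add0r.
  apply: (cvg_eq (u := fun n => th n * m%:R + th n * n%:R)).
    by near=> n; rewrite natrD mulrDr.
  exact: cvgD.
have wN1 : w n ^+ (N n).+1 @[n --> \oo] --> expR a.
  apply: cvg_invB_expn => //; rewrite -[X in _ --> X]add0r.
  apply: (cvg_eq (u := fun n => th n * m.+1%:R + th n * n%:R)).
    by near=> n; rewrite -addSn natrD mulrDr.
  exact: cvgD.
have wm : w n ^+ m - 1 @[n --> \oo] --> (0 : R).
  rewrite -(subrr (1 : R)) -[X in X - _]expR0; apply: cvgB; last exact: cvg_cst.
  exact: (cvg_invB_expn (k := fun=> m)).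
have dth : d n / th n @[n --> \oo] --> rho2 / 2.
  apply: (cvg_eq (u := fun n => e1 n * (rho2 / 2))).
    near=> n; rewrite excessE /th /k; field.
    have /andP[_ h] := eps01 n.
    by rewrite !gt_eqF ?subr_gt0 // subr_eq0 gt_eqF.
  by rewrite -[X in _ --> X]mul1r; apply: cvgM; [exact: cvg_e1|exact: cvg_cst].
have a0 : 0 < a by rewrite !mulr_gt0 ?invr_gt0.
have ha : a / 2 < a by rewrite ltr_pdivrMr // ltr_pMr // ltr1n.
(* This is where C > 0 is used: p n is bounded and theta n stays away
   from 0. *)
have pth : \forall n \near \oo, p n / th n <= (rho2 + 2) * (2 / a).
  near=> n; have /andP[p0 _] := p01 n.
  have h1 : p n * n%:R <= rho2 + 2 by near: n; exact: loss_bounded.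
  have h2 : a / 2 < th n * n%:R by near: n; exact: (cvgr_gt a thn).
  have n0 : (0 : R) < n%:R by rewrite ltr0n; near: n; exact: nbhs_infty_gt.
  have -> : p n / th n = p n * n%:R / (th n * n%:R).
    by field; rewrite !gt_eqF.
  rewrite ler_pM ?mulr_ge0 ?invr_ge0 ?ler0n //.
    by rewrite mulr_ge0 // ltW.
  by rewrite -[leRHS]invf_div lef_pV2 ?posrE ?mulr_gt0 // ?invr_gt0 // ltW.
have wmp : (w n ^+ m - 1) * (p n / th n) @[n --> \oo] --> (0 : R).
  apply: (cvg0_le (r := fun n => `|w n ^+ m - 1| * ((rho2 + 2) * (2 / a)))).
    near=> n; have /andP[p0 _] := p01 n.
    rewrite normrM ler_wpM2l // ger0_norm ?mulr_ge0 ?invr_ge0 ?(ltW (th0 n)) //.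
    by near: n; exact: pth.
  rewrite -(mul0r ((rho2 + 2) * (2 / a))); apply: cvgM; last exact: cvg_cst.
  by rewrite -(normr0 R); exact: cvg_norm.
have main : p n / th n * (w n ^+ N n - 1) - d n / th n @[n --> \oo] --> (0 : R).
  apply: (cvg0_le (r := fun n =>
    2 * w n ^+ (N n).+1 * (`|e2 n / 2 - d n / th n| + th n * M)
    + ((w n ^+ m - 1) * (d n / th n) + (w n ^+ m - 1) * (p n / th n))
    + (1 + M) * Num.sqrt (L n))).
    near=> n.
    have tn : 0 < th n < 1.
      by rewrite th0 /=; near: n; apply: (cvgr_lt _ thc); exact: ltr01.
    have := exp_estimate n tn (erefl (w n)).
    rewrite -(ler_pM2l (x := (th n)^-1)) ?invr_gt0 //.
    rewrite -[X in X * `|p n * _ - _|]gtr0_norm ?invr_gt0 // -normrM.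
    have nz : th n != 0 by rewrite gt_eqF.
    have -> : (th n)^-1 * (p n * (w n ^+ N n - 1) - d n) =
      p n / th n * (w n ^+ N n - 1) - d n / th n by ring.
    move=> /le_trans; apply.
    have -> : th n * e2 n / 2 - d n = th n * (e2 n / 2 - d n / th n).
      by move: (d n) (th n) nz => q1 q2 nz; field.
    rewrite normrM (gtr0_norm (th0 n)).
    move: (`|e2 n / 2 - d n / th n|) (_ ^+ (N n).+1) (_ ^+ m) (Num.sqrt (L n)) (e1 n)
      (th n) nz => q1 q2 q3 q4 q5 q6 nz.
    by rewrite le_eqVlt; apply/orP; left; apply/eqP; field.
  have -> : (0 : R) = 2 * expR a * (`|rho2 / 2 - rho2 / 2| + 0 * M)
      + (0 * (rho2 / 2) + 0) + (1 + M) * 0.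
    by rewrite subrr normr0 !(mul0r, mulr0, addr0).
  apply: cvgD; last by apply: cvgM; [exact: cvg_cst|exact: cvg_sqrt0 cvg_L].
  apply: cvgD; last by apply: cvgD => //; exact: cvgM.
  apply: cvgM; first by apply: cvgM => //; exact: cvg_cst.
  apply: cvgD; last by apply: cvgM => //; exact: cvg_cst.
  apply: cvg_norm; apply: cvgB => //.
  by apply: cvgM => //; exact: cvg_cst.
have ea : expR a - 1 != 0 by rewrite subr_eq0 gt_eqF // -expR0 ltr_expR.
have res : p n / th n * (w n ^+ N n - 1) @[n --> \oo] --> rho2 / 2.
  rewrite -[X in _ --> X]add0r.
  apply: (cvg_eq (u := fun n =>
    p n / th n * (w n ^+ N n - 1) - d n / th n + d n / th n)).
    by near=> n; rewrite subrK.
  exact: cvgD.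
have wN' : w n ^+ N n - 1 @[n --> \oo] --> expR a - 1.
  by apply: cvgB => //; exact: cvg_cst.
rewrite -/a (_ : (expR a - 1)^-1 = rho2 / 2 * (expR a - 1)^-1 * k); last first.
  by rewrite /k; field; rewrite ea gt_eqF.
apply: (cvg_eq (u := fun n => p n / th n * (w n ^+ N n - 1) * (w n ^+ N n - 1)^-1 * k)).
  near=> n; have wn0 : w n ^+ N n - 1 != 0.
    rewrite gt_eqF //; near: n; apply: (cvgr_gt _ wN').
    by rewrite subr_gt0 -expR0 ltr_expR.
  by rewrite mulfK // /th; field; rewrite !gt_eqF.
apply: cvgM; last exact: cvg_cst.
by apply: cvgM => //; exact: cvgV.
Unshelve. all: by end_near. Qed.

End LossLimits.

(** * Asymptotics of the loss probability *)

Lemma loss_load (R : realType) (m : nat) (mu lam eps : R)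
    (A : probability (measurableTypeR R) R) :
  (0 < m)%N -> 0 < mu -> nonneg_law A -> 0 < lam ->
  mean A = (1 / lam)%:E -> lam / (m%:R * mu) = 1 - eps ->
  scaled_moment m mu A 1 = (1 - eps)^-1.
Proof.
move=> m0 mu0 A0 lam0 Am load.
have xi : integ A idfun.
  apply: integ_ge0_fin => //; first by move=> x; exact: cvg_id.
  by rewrite [X in (X < _)%E](_ : _ = mean A) // Am ltry.
have xE : expect A idfun = 1 / lam.
  by apply: EFin_inj; rewrite -Am -(expectE xi).
rewrite /scaled_moment (_ : (fun t => _) = fun t => mu * m%:R * idfun t); last first.
  by apply/funext => t; rewrite expr1.
have mr0 : (m%:R : R) != 0 by rewrite pnatr_eq0 -lt0n.
rewrite expectZ // xE -load; field.
by rewrite mr0 !gt_eqF.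
Qed.

Lemma equiv_of_cvg_ratio (R : realType) (p eps : nat -> R) (k : R) :
  (forall n, 0 < eps n) -> 0 < k -> p n / eps n @[n --> \oo] --> k ->
  p ~_\oo (fun n => eps n * k).
Proof.
move=> eps0 k0 pk; apply/eqaddoP => e e0; near=> n.
have h : `|k - p n / eps n| <= e * k.
  by near: n; apply: (cvgr_dist_le _ _ pk); rewrite mulr_gt0.
have en := eps0 n.
rewrite [leLHS](_ : _ = eps n * `|k - p n / eps n|).
  rewrite (gtr0_norm (mulr_gt0 en k0)) mulrCA ler_pM2l //.
rewrite -[X in X * _](gtr0_norm en) -normrM -normrN; congr `|_|.
rewrite mulrBr mulrCA divff ?gt_eqF // mulr1 opprB //.
Unshelve. all: by end_near. Qed.

Lemma littleo_inv_of_cvg (R : realType) (p : nat -> R) (l : R) :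
  p n * n%:R @[n --> \oo] --> l / 2 ->
  p = (fun n => l / (2 * n%:R)) +o_\oo (fun n => n%:R^-1 : R).
Proof.
move=> pl; apply/eqaddoP => e e0; near=> n.
have h : `|l / 2 - p n * n%:R| <= e by near: n; exact: (cvgr_dist_le _ _ pl).
have n0 : (0 : R) < n%:R by rewrite ltr0n; near: n; exact: nbhs_infty_gt.
have i0 : 0 < (n%:R^-1 : R) by rewrite invr_gt0.
rewrite [leLHS](_ : _ = n%:R^-1 * `|l / 2 - p n * n%:R|).
  by rewrite (gtr0_norm i0) mulrC ler_pM2r.
rewrite -[X in X * _](gtr0_norm i0) -normrM -normrN; congr `|_|.
rewrite !fctE; field; exact: lt0r_neq0.
Unshelve. all: by end_near. Qed.

Unset Implicit Arguments.
Set Strict Implicit.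

Theorem theorem3p2 (R : realType) (m : nat) (hm : (1 <= m)%N)
    (mu lam : nat -> R) (A : nat -> probability (measurableTypeR R) R)
    (p eps : nat -> R) (C rho2 : R)
    (mu_gt0 : forall n, 0 < mu n)
    (A_nonneg : forall n, nonneg_law (A n))
    (lam_gt0 : forall n, 0 < lam n)
    (A_mean : forall n, mean (A n) = (1 / lam n)%:E)
    (p_loss : forall n, is_loss_probability m n (mu n) (A n) (p n))
    (load_eps : forall n, lam n / (m%:R * mu n) = 1 - eps n)
    (eps_gt0 : forall n, 0 < eps n)
    (eps_cvg0 : eps n @[n --> \oo] --> 0)
    (C_ge0 : 0 <= C)
    (eps_n_cvg : eps n * n%:R @[n --> \oo] --> C)
    (rho3_bounded :
       exists M : R, forall n, (rho_moment m (mu n) (A n) 3 <= M%:E)%E)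
    (rho2_cvg : rho_moment m (mu n) (A n) 2 @[n --> \oo] --> rho2%:E) :
  (0 < C ->
     p ~_\oo (fun n => eps n * expR (- (2 * C / rho2))
                       / (1 - expR (- (2 * C / rho2)))))
  /\
  (C = 0 ->
     p = (fun n => rho2 / (2 * n%:R)) +o_\oo (fun n => n%:R^-1 : R)).
Proof.
have [M rho3M] := rho3_bounded.
pose e2 n := scaled_moment m (mu n) (A n) 2.
have eps01 n : 0 < eps n < 1.
  rewrite eps_gt0 -subr_gt0 -load_eps divr_gt0 // mulr_gt0 // ltr0n //.
have e1E n : scaled_moment m (mu n) (A n) 1 = (1 - eps n)^-1.
  exact: (loss_load hm (mu_gt0 n) (A_nonneg n) (lam_gt0 n) (A_mean n) (load_eps n)).
have e1_gt1 n : 1 < scaled_moment m (mu n) (A n) 1.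
  have /andP[h0 h1] := eps01 n.
  by rewrite e1E invf_gt1 ?subr_gt0 // gtrBl.
have e2c : e2 n @[n --> \oo] --> rho2.
  apply: fine_cvg; apply: cvg_trans rho2_cvg; apply: near_eq_cvg; near=> n.
  rewrite /rho_moment (expectE (g := fun x => (mu n * m%:R * x) ^+ 2)) //.
  by apply: (integ_power hm (mu_gt0 n) (A_nonneg n) (rho3M n)).
have p01 n : 0 <= p n <= 1 by exact: loss_probability_bounds (p_loss n).
have e2_ge n : 2 * (1 - eps n)^-1 - 1 <= e2 n.
  by have := (scaled_moment2_ge hm (mu_gt0 n) (A_nonneg n) (rho3M n)); rewrite e1E.
have qu n : p n * (2 * (m + n)%:R + 1 - 2 * (1 - eps n)^-1) <=
    e2 n + 2 * m%:R * ((1 - eps n)^-1 - 1 + p n).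
  by have := loss_quad_upper hm (mu_gt0 n) (A_nonneg n) (rho3M n)
    (p_loss n) (e1_gt1 n); rewrite e1E.
have qe n : `|p n * (2 * (m + n)%:R + 1 - 2 * (1 - eps n)^-1) - e2 n| <=
    (2 * (m + n)%:R + 1) * ((1 - eps n)^-1 - 1) +
    (2 * m%:R + 1) * ((1 - eps n)^-1 - 1 + p n) +
    2 * (1 + M) * Num.sqrt ((1 - eps n)^-1 - 1 + p n).
  by have := loss_quad_estimate hm (mu_gt0 n) (A_nonneg n) (rho3M n)
    (p_loss n) (e1_gt1 n); rewrite e1E.
split=> [C0|C0].
  have a0 : 0 < 2 * C / rho2.
    have r1 := rho2_ge1 eps_cvg0 e2c e2_ge.
    by rewrite divr_gt0 ?mulr_gt0 // (lt_le_trans ltr01).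
  have ea : 1 < expR (2 * C / rho2) by rewrite -[X in X < _]expR0 ltr_expR.
  have kE : expR (- (2 * C / rho2)) / (1 - expR (- (2 * C / rho2))) =
      (expR (2 * C / rho2) - 1)^-1.
    move: ea; rewrite expRN; move: (expR _) => x x1; field.
    by rewrite subr_eq0 !gt_eqF // (lt_trans ltr01).
  under [X in _ = X +o_\oo X]eq_fun do rewrite -mulrA kE.
  apply: equiv_of_cvg_ratio => //.
    by rewrite invr_gt0 subr_gt0.
  apply: (cvg_loss_pos (m := m) (e2 := e2) (M := M)) => // n th w h0 h1.
  by have := loss_exp_estimate hm (mu_gt0 n) (A_nonneg n) (rho3M n)
    (p_loss n) (e1_gt1 n) h0 h1; rewrite e1E.
apply: littleo_inv_of_cvg.
exact: (cvg_loss_null (m := m) (e2 := e2) (M := M) (C := C)).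
Unshelve. all: by end_near. Qed.
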